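(* Let $\mathbb{K}=\mathbb{R}$ or $\mathbb{C}$, let $\alpha_0,\alpha_1>0$ be real numbers, put $\alpha=\alpha_1/\alpha_0$, and equip the Stiefel manifold $\mathrm{St}_{\mathbb{K},p,n}$ with the Riemannian metric induced by $\mathsf{g}_Y\omega=\alpha_0\omega+(\alpha_1-\alpha_0)YY^{\mathfrak t}\omega$. Then the geodesic equation for this metric is $$\ddot Y+Y\dot Y^{\mathfrak t}\dot Y+2(1-\alpha)(I_n-YY^{\mathfrak t})(\dot Y\dot Y^{\mathfrak t})Y=0.$$ Moreover, let $\tilde Y\in\mathrm{St}_{\mathbb{K},p,n}$ and let $\eta$ be a tangent vector to $\mathrm{St}_{\mathbb{K},p,n}$ at $\tilde Y$. Let $A=\tilde Y^{\mathfrak t}\eta$. Let $Q$ be a matrix whose columns form an orthonormal basis of the column span of $\eta-\tilde Y\tilde Y^{\mathfrak t}\eta$, and write $\eta-\tilde Y\tilde Y^{\mathfrak t}\eta=QR$. Let $S_0:=\eta^{\mathfrak t}\eta$; then $S_0=-A^2+R^{\mathfrak t}R$. Each of the two formulas below describes the geodesic $Y(t)$ with $Y(0)=\tilde Y$ and $\dot Y(0)=\eta$: $$Y(t)=\begin{bmatrix}\tilde Y&\eta\end{bmatrix}\left\{\exp t\begin{bmatrix}(2\alpha-1)A&2(\alpha-1)A^2-S_0\\ I_p&A\end{bmatrix}\right\}\begin{bmatrix}\exp((1-2\alpha)tA)\\0\end{bmatrix},$$ $$Y(t)=(\tilde Y M(t)+Q N(t))\exp((1-2\alpha)tA)\quad\text{with}\quad\begin{bmatrix}M(t)\\N(t)\end{bmatrix}=\exp\left(t\begin{bmatrix}2\alpha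 A&-R^{\mathfrak t}\\R&0\end{bmatrix}\right)\begin{bmatrix}I_p\\0\end{bmatrix}.$$
   Context: $\mathfrak t$ denotes the transpose if $\mathbb{K}=\mathbb{R}$ and the Hermitian (conjugate) transpose if $\mathbb{K}=\mathbb{C}$. $\mathrm{Tr}_{\mathbb{R}}$ is the trace if $\mathbb{K}=\mathbb{R}$ and the real part of the trace if $\mathbb{K}=\mathbb{C}$. The Stiefel manifold is $\mathrm{St}_{\mathbb{K},p,n}=\{Y\in\mathbb{K}^{n\times p}: Y^{\mathfrak t}Y=I_p\}$ (a real manifold); its tangent vectors at $Y$ are identified with matrices $\eta\in\mathbb{K}^{n\times p}$ such that $Y^{\mathfrak t}\eta+\eta^{\mathfrak t}Y=0$. The metric is the restriction to tangent spaces of the real inner product $\langle\omega_1,\omega_2\rangle_Y=\mathrm{Tr}_{\mathbb{R}}\,\omega_1^{\mathfrak t}(\mathsf{g}_Y\omega_2)$ with $\mathsf{g}_Y\omega=\alpha_0\omega+(\alpha_1-\alpha_0)YY^{\mathfrak t}\omega$ on $\mathbb{K}^{n\times p}$. Geodesics are those of the Levi-Civita connection of this metric; $\exp$ is the matrix exponential. If the column span of $\eta-\tilde Y\tilde Y^{\mathfrak t}\eta$ has dimension $k$ then $Q\in\mathbb{K}^{n\times k}$, $R\in\mathbb{K}^{k\times p}$ (with $k=0$ allowed, in which case the $Q,R,N$ terms are absent). *)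

(* Defs.v *)
From HB Require Import structures.
From mathcomp Require Import all_boot all_order all_algebra.
From mathcomp Require Import all_classical all_reals all_analysis.
From mathcomp Require Import complex.

Set Implicit Arguments.
Unset Strict Implicit.
Unset Printing Implicit Defensive.

Import Order.TTheory GRing.Theory Num.Theory.
Import numFieldNormedType.Exports.

Local Open Scope classical_set_scope.
Local Open Scope ring_scope.

Inductive scalars := RealScalars | ComplexScalars.

Section Scalars.
Variable R : realType.

Definition scal (K : scalars) : fieldType :=
  match K with RealScalars => R | ComplexScalars => R[i] end.

Definition conjK (K : scalars) : scal K -> scal K :=
  match K return scal K -> scal K with RealScalars => fun x => x | ComplexScalars => @conjc R end.

Definition reK (K : scalars) : scal K -> R :=
  match K return scal K -> R with RealScalars => fun x => x | ComplexScalars => @complex.Re R end.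

Definition ofR (K : scalars) : R -> scal K :=
  match K return R -> scal K with RealScalars => fun x => x | ComplexScalars => fun x => Complex x 0 end.

Definition absK (K : scalars) : scal K -> R :=
  match K return scal K -> R with RealScalars => fun x : R => `|x|
             | ComplexScalars => @Normc.normc R end.

Lemma ofRD K : {morph @ofR K : x y / x + y}.
Proof. by case: K => //= x y; exact: (raddfD (real_complex R)). Qed.

Lemma ofRM K : {morph @ofR K : x y / x * y}.
Proof. by case: K => //= x y; exact: (rmorphM (real_complex R)). Qed.

Lemma ofR1 K : @ofR K 1 = 1.
Proof. by case: K. Qed.

Lemma absK_triangle K (x y : scal K) : absK (x + y) <= absK x + absK y.
Proof. by case: K x y => /= x y; [exact: ler_normD | exact: (@ler_normD R (Rcomplex R) x y)]. Qed.

Lemma absK_ge0 K (x : scal K) : 0 <= absK x.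
Proof. by case: K x => [x|[a b]] /=; [exact: normr_ge0 | exact: sqrtr_ge0]. Qed.

Lemma absK_eq0 K (x : scal K) : absK x = 0 -> x = 0.
Proof.
by case: K x => /= x; [move/eqP; rewrite normr_eq0 => /eqP | exact: Normc.eq0_normc].
Qed.

Lemma absKZ K (r : R) (x : scal K) : absK (ofR K r * x) = `|r| * absK x.
Proof.
case: K x => /= x; first exact: normrM.
by rewrite Normc.normcM /= expr0n /= addr0 sqrtr_sqr.
Qed.

End Scalars.

(** [mat R K m n] is ['M[scal R K]_(m, n)] with its scalars restricted to [R],
    so that the differential calculus of the library (['d], [derive1], ...) is
    taken over the reals also for complex matrices.  The l1 norm is only used
    for the topology and the calculus, for which all norms are equivalent. *)

Definition mat (R : realType) (K : scalars) (m n : nat) : Type :=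
  'M[scal R K]_(m, n).

Section MatNormed.
Variables (R : realType) (K : scalars) (m n : nat).
Local Notation E := (mat R K m n).

HB.instance Definition _ := GRing.Zmodule.on E.

Definition mat_scale (r : R) (A : E) : E :=
  (ofR K r : scal R K) *: (A : 'M[scal R K]_(m, n)).

Lemma mat_scaleA r s A : mat_scale r (mat_scale s A) = mat_scale (r * s) A.
Proof. by rewrite /mat_scale scalerA ofRM. Qed.

Lemma mat_scale1 : left_id 1 mat_scale.
Proof. by move=> A; rewrite /mat_scale ofR1 scale1r. Qed.

Lemma mat_scaleDr : right_distributive mat_scale +%R.
Proof. by move=> r A B; rewrite /mat_scale -scalerDr. Qed.

Lemma mat_scaleDl A : {morph mat_scale^~ A : r s / r + s}.
Proof. by move=> r s; rewrite /mat_scale ofRD scalerDl. Qed.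

HB.instance Definition _ := GRing.Zmodule_isLmodule.Build R E
  mat_scaleA mat_scale1 mat_scaleDr mat_scaleDl.

Definition mat_norm (A : E) : R := \sum_i \sum_j absK (A i j).

Lemma mat_normD A B : mat_norm (A + B) <= mat_norm A + mat_norm B.
Proof.
rewrite /mat_norm -big_split ler_sum //= => i _.
by rewrite -big_split ler_sum //= => j _; rewrite mxE absK_triangle.
Qed.

Lemma mat_normZ (r : R) A : mat_norm (r *: A) = `|r| * mat_norm A.
Proof.
rewrite /mat_norm mulr_sumr; apply: eq_bigr => i _.
by rewrite mulr_sumr; apply: eq_bigr => j _; rewrite mxE absKZ.
Qed.

Lemma mat_norm_eq0 A : mat_norm A = 0 -> A = 0.
Proof.
move=> A0; apply/matrixP => i j; rewrite mxE; apply: absK_eq0.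
have rge0 k : 0 <= \sum_l absK (A k l) by apply: sumr_ge0 => l _; exact: absK_ge0.
have /(_ (fun k _ => rge0 k)) := psumr_eq0P _ A0.
move=> /(_ i isT) Ai0.
by have /(_ (fun k _ => absK_ge0 _)) := psumr_eq0P _ Ai0; apply.
Qed.

HB.instance Definition _ := Lmodule_isNormed.Build R E
  mat_normD mat_normZ mat_norm_eq0.

End MatNormed.

Section MatOps.
Variables (R : realType) (K : scalars).

Definition mmul m n p (A : mat R K m n) (B : mat R K n p) : mat R K m p := A *m B.

Definition mid n : mat R K n n := 1%:M.

Definition adj m n (A : mat R K m n) : mat R K n m :=
  map_mx (@conjK R K) (trmx A).

Definition trR n (A : mat R K n n) : R := reK (\tr A).

Definition mpow n (A : mat R K n n) (i : nat) : mat R K n n := iter i (mmul A) (mid n).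

Definition mexp n (A : mat R K n n) : mat R K n n :=
  lim (series (fun i => (i`!%:R : R)^-1 *: mpow A i) @ \oo).

Definition mrow m n p (A : mat R K m n) (B : mat R K m p) : mat R K m (n + p) :=
  row_mx A B.

Definition mcol m n p (A : mat R K m p) (B : mat R K n p) : mat R K (m + n) p :=
  col_mx A B.

Definition mblock m1 m2 n1 n2 (A : mat R K m1 n1) (B : mat R K m1 n2)
  (C : mat R K m2 n1) (D : mat R K m2 n2) : mat R K (m1 + m2) (n1 + n2) :=
  block_mx A B C D.

(* the columns of [Q] form an orthonormal basis of the column span of [W]; the
   matrix spaces of the library are row spaces, whence the transpositions *)
Definition orthonormal_basis_of_columns m n k (Q : mat R K m k) (W : mat R K m n) :=
  mmul (adj Q) Q = mid k /\ (trmx Q == trmx W)%MS.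

End MatOps.

Arguments mid {R K} n.

Declare Scope mat_scope.
Delimit Scope mat_scope with mat.
Notation "A ** B" := (mmul A B) (at level 40, left associativity) : mat_scope.
Notation "A ^t" := (adj A) (at level 1, format "A ^t") : mat_scope.

(* [Ck_on] is only used on open sets [D] *)
Section Smooth.
Variables (R : realType) (V W : normedModType R).

Fixpoint Ck_on (k : nat) (D : set V) (f : V -> W) : Prop :=
  match k with
  | 0%N => forall x, D x -> {for x, continuous f}
  | k'.+1 => (forall x, D x -> differentiable f x) /\
             forall v : V, Ck_on k' D (fun x => 'd f x v)
  end.

Definition smooth_on (D : set V) (f : V -> W) := forall k, Ck_on k D f.

End Smooth.

(** [M] is a closed embedded submanifold of [E], [T Y] its tangent space at [Y]
    and [g Y] an inner product on [E] whose restriction to [T Y] is the metric.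
    As [M] is closed, the smooth functions and fields on [M] are the restrictions
    of the smooth maps on [E]; a field on [M] is represented by any such extension.
    Similarly a field along a curve [c : I -> M] is represented by a map on [R] of
    which only the restriction to the open set [I] matters. *)

Section Geodesics.
Variables (R : realType) (E : normedModType R).
Variables (M : set E) (T : E -> set E) (g : E -> E -> E -> R).

Definition vector_field (U : E -> E) :=
  smooth_on setT U /\ forall Y, M Y -> T Y (U Y).

(* [nabla Y u U] is the derivative of the field [U] in the direction [u] of
   [T Y] *)
Record is_connection (nabla : E -> E -> (E -> E) -> E) : Prop := {
  conn_tangent : forall Y u U, M Y -> T Y u -> vector_field U ->
    T Y (nabla Y u U);
  conn_ext : forall Y u U V, M Y -> T Y u -> vector_field U -> vector_field V ->
    (forall Z, M Z -> U Z = V Z) -> nabla Y u U = nabla Y u V;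
  conn_smooth : forall X U, vector_field X -> vector_field U ->
    exists2 V, vector_field V & forall Y, M Y -> V Y = nabla Y (X Y) U;
  conn_linear_dir : forall (a : R) Y u v U, M Y -> T Y u -> T Y v ->
    vector_field U ->
    nabla Y (a *: u + v) U = a *: nabla Y u U + nabla Y v U;
  conn_linear : forall (a : R) Y u U V, M Y -> T Y u ->
    vector_field U -> vector_field V ->
    nabla Y u (fun Z => a *: U Z + V Z) = a *: nabla Y u U + nabla Y u V;
  conn_leibniz : forall Y u (f : E -> R^o) U, M Y -> T Y u ->
    smooth_on setT f -> vector_field U ->
    nabla Y u (fun Z => f Z *: U Z) = 'd f Y u *: U Y + f Y *: nabla Y u U }.

(* the Lie bracket of two fields tangent to [M] is computed in [E] *)
Definition torsion_free (nabla : E -> E -> (E -> E) -> E) :=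
  forall Y U V, M Y -> vector_field U -> vector_field V ->
  nabla Y (U Y) V - nabla Y (V Y) U = 'd V Y (U Y) - 'd U Y (V Y).

Definition metric_compatible (nabla : E -> E -> (E -> E) -> E) :=
  forall Y u U V, M Y -> T Y u -> vector_field U -> vector_field V ->
  'd (fun Z => g Z (U Z) (V Z) : R^o) Y u =
    g Y (nabla Y u U) (V Y) + g Y (U Y) (nabla Y u V).

Definition levi_civita (nabla : E -> E -> (E -> E) -> E) :=
  [/\ is_connection nabla, torsion_free nabla & metric_compatible nabla].

Definition curve_in (I : set R) (c : R -> E) :=
  smooth_on (I : set R^o) (c : R^o -> E) /\ forall t, I t -> M (c t).

Definition field_along (I : set R) (c V : R -> E) :=
  smooth_on (I : set R^o) (V : R^o -> E) /\ forall t, I t -> T (c t) (V t).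

Record covariant_derivative_along (nabla : E -> E -> (E -> E) -> E)
    (I : set R) (c : R -> E) (Dt : (R -> E) -> R -> E) : Prop := {
  cov_field : forall V, field_along I c V -> field_along I c (Dt V);
  cov_ext : forall V W, field_along I c V -> field_along I c W ->
    (forall t, I t -> V t = W t) -> forall t, I t -> Dt V t = Dt W t;
  cov_linear : forall (a : R) V W, field_along I c V -> field_along I c W ->
    forall t, I t -> Dt (fun s => a *: V s + W s) t = a *: Dt V t + Dt W t;
  cov_leibniz : forall (f : R -> R) V,
    smooth_on (I : set R^o) (f : R^o -> R^o) -> field_along I c V ->
    forall t, I t ->
    Dt (fun s => f s *: V s) t = derive1 (f : R^o -> R^o) t *: V t + f t *: Dt V t;
  cov_chain : forall U, vector_field U ->
    forall t, I t -> Dt (U \o c) t = nabla (c t) (derive1 (c : R^o -> E) t) U }.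

(* on tangent vectors and tangent fields the Levi-Civita connection, and the
   covariant derivative it induces along [c], exist and are unique, so the
   existential only names them *)
Definition geodesic (I : set R) (c : R -> E) :=
  curve_in I c /\
  exists nabla Dt, [/\ levi_civita nabla,
    covariant_derivative_along nabla I c Dt &
    forall t, I t -> Dt (derive1 (c : R^o -> E)) t = 0].

End Geodesics.

Section Stiefel.
Variables (R : realType) (K : scalars) (n p : nat).
Local Open Scope mat_scope.

Definition stiefel : set (mat R K n p) := [set Y | Y^t ** Y = mid p].

Definition stiefel_tangent (Y : mat R K n p) : set (mat R K n p) :=
  [set eta | Y^t ** eta + eta^t ** Y = 0].

Definition stiefel_gop (alpha0 alpha1 : R) (Y w : mat R K n p) : mat R K n p :=
  alpha0 *: w + (alpha1 - alpha0) *: (Y ** Y^t ** w).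

Definition stiefel_inner (alpha0 alpha1 : R) (Y w1 w2 : mat R K n p) : R :=
  trR (w1^t ** stiefel_gop alpha0 alpha1 Y w2).

Definition stiefel_curve (I : set R) (Y : R -> mat R K n p) :=
  curve_in stiefel I Y.

Definition stiefel_geodesic (alpha0 alpha1 : R) (I : set R) (Y : R -> mat R K n p) :=
  geodesic stiefel stiefel_tangent (stiefel_inner alpha0 alpha1) I Y.

End Stiefel.

(* Main.v *)
From HB Require Import structures.
Require Import Defs.
From mathcomp Require Import all_boot all_order all_algebra.
From mathcomp Require Import all_classical all_reals all_analysis.
From mathcomp Require Import complex ring lra.
Import Order.TTheory GRing.Theory Num.Theory.
Import numFieldNormedType.Exports.
Local Open Scope classical_set_scope.
Local Open Scope ring_scope.
Local Open Scope mat_scope.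

(** The Levi-Civita connection is [D_u U + Gam(u, U)], where [Gam] is the
    polarization of the quadratic term of the geodesic equation; it is the only
    one by Koszul's argument, and the covariant derivative along a curve is
    determined by it because a field along the curve is a combination of
    restrictions of globally defined tangent fields.

    Along a solution [Y] of the geodesic equation [A = Y^t ** Y'] is constant and
    [Y'^t ** Y'] is conjugated by [exp (c t A)], [c = 2 alpha - 1].  Hence
    [[Y Y'] ** exp (c t A)] solves a linear system with constant coefficients,
    which gives the first formula; conversely the Gram matrix of a solution of
    this system is a first integral.  In the second formula, the matrix
    [[I A; 0 R]] intertwines the two generators. *)

Set Implicit Arguments.
Unset Strict Implicit.
Unset Printing Implicit Defensive.

(** * Differential calculus *)

(** All differentials are taken in the ambient matrix space, whereas fields and metric only matter
    on the manifold. The link is that every tangent vector is the velocity of a curve lying in the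
    manifold: an identity valid on the manifold can then be differentiated in tangent directions.
    Such a curve is supplied by the exponential formula itself, so the linear system is solved
    before any connection is introduced.

    Origin of [c]: put [S = Y'^t ** Y']. Since [A] is constant and skew, the geodesic equation reads
    [Y'' = - Y S + 2 (1 - alpha) (Y' A - Y A A)], which gives [S' = c (A S - S A)], the equation of
    a conjugation by [exp (c t A)]. In the form [S exp (c t A) = exp (c t A) S0] it replaces the
    moving [S] by [S0] in the system for [[Y Y'] ** exp (c t A)]; this is why that system has
    constant coefficients.

    The matrix [[I A; 0 R]] expresses [[Y0 eta]] in terms of [[Y0 Q]]. *)

Record bounded_bilinear (R : realType) (U V W : normedModType R)
    (B : U -> V -> W) : Prop := {
  bil_linl : forall v, linear (B ^~ v);
  bil_linr : forall u, linear (B u);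
  bil_bound : exists C : R, forall u v, `|B u v| <= C * `|u| * `|v| }.

Record bounded_linear (R : realType) (U V : normedModType R) (f : U -> V) : Prop := {
  bl_linear : linear f;
  bl_bound : exists C : R, forall u, `|f u| <= C * `|u| }.

Section LinearFunctions.
Variables (R : pzRingType) (V W : lmodType R) (f : V -> W).
Hypothesis fl : linear f.

Lemma linear_fun0 : f 0 = 0.
Proof. by have := fl (-1) 0 0; rewrite scaler0 addr0 scaleN1r addNr. Qed.

Lemma linear_funD u v : f (u + v) = f u + f v.
Proof. by have := fl 1 u v; rewrite !scale1r. Qed.

Lemma linear_funZ a u : f (a *: u) = a *: f u.
Proof. by have := fl a u 0; rewrite !addr0 linear_fun0 addr0. Qed.

Lemma linear_sumZ (I : Type) (r : seq I) (c : I -> R) (v : I -> V) :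
  f (\sum_(i <- r) c i *: v i) = \sum_(i <- r) c i *: f (v i).
Proof.
elim: r => [|i r IH]; first by rewrite !big_nil linear_fun0.
by rewrite !big_cons fl IH.
Qed.

End LinearFunctions.

Section Calculus.
Variable R : realType.
Implicit Types U V W X : normedModType R.

Lemma is_diff_bl U V X (L : U -> V) (f df : X -> U) (x : X) :
  bounded_linear L -> is_diff x f df -> is_diff x (L \o f) (L \o df).
Proof.
move=> [Llin [C LC]] fdf.
pose LM := GRing.isLinear.Build _ _ _ _ _ Llin.
pose LL : {linear _ -> _} := HB.pack L LM.
have cL : continuous LL.
  apply: bounded_linear_continuous; apply/linear_boundedP.
  exists C; split; first exact: num_real.
  move=> r Cr u; apply: le_trans (LC u) _.
  by rewrite ler_wpM2r // ltW.
apply: is_diff_comp; apply: DiffDef; first exact: (linear_differentiable _ cL).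
exact: (diff_lin _ cL).
Qed.

Lemma bil_continuous U V W (B : U -> V -> W) :
  bounded_bilinear B -> continuous (fun p : U * V => B p.1 p.2).
Proof.
move=> [Bl Br [C BC]].
move=> [u0 v0]; apply/(@cvgrPdist_lt _ _ _ (nbhs (u0, v0))) => e e0.
have C1 : 0 < `|C| + 1 by rewrite ltr_pwDr // normr_ge0.
have BC1 u v : `|B u v| <= (`|C| + 1) * (`|u| * `|v|).
  rewrite (le_trans (BC _ _)) // -mulrA ler_wpM2r ?mulr_ge0 //.
  by rewrite (le_trans (ler_norm _)) // lerDl.
have K0 : 0 < `|u0| + `|v0| + 1 by rewrite ltr_pwDr // addr_ge0.
(* The bound 1 keeps [|u|] below [|u0| + 1]; the other bound controls the sum
   [d |v0| + (|u0| + 1) d] of the two error terms. *)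
pose d := Num.min 1 (e / ((`|C| + 1) * (`|u0| + `|v0| + 1))).
have d0 : 0 < d by rewrite lt_min ltr01 /= divr_gt0 // mulr_gt0.
apply/nbhs_ballP; exists d => //= -[u v] [/= ]; rewrite -!ball_normE /= => hu hv.
have -> : B u0 v0 - B u v = B (u0 - u) v0 + B (u0 + (u - u0)) (v0 - v).
  rewrite (addrC u0 (u - u0)) subrK.
  have -> : B (u0 - u) v0 = B u0 v0 - B u v0.
    by rewrite [RHS]addrC -(scaleN1r (B u v0)) -(Bl v0 (-1)) scaleN1r addrC.
  have -> : B u (v0 - v) = B u v0 - B u v.
    by rewrite [RHS]addrC -(scaleN1r (B u v)) -(Br u (-1)) scaleN1r addrC.
  by rewrite addrA subrK.
apply: le_lt_trans (ler_normD _ _) _.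
apply: le_lt_trans (lerD (BC1 _ _) (BC1 _ _)) _.
rewrite -mulrDr -ltr_pdivlMl // [ltRHS]mulrC.
have d1 : d <= 1 by rewrite /d ge_min lexx.
have hu' : `|u0 + (u - u0)| <= `|u0| + 1.
  rewrite (le_trans (ler_normD _ _)) // lerD2l distrC.
  exact: le_trans (ltW hu) d1.
have dK : d * (`|u0| + `|v0| + 1) <= e / (`|C| + 1).
  rewrite -ler_pdivlMr // (le_trans (_ : d <= e / ((`|C| + 1) * (`|u0| + `|v0| + 1)))) //.
    by rewrite /d ge_min lexx orbT.
  by rewrite invfM mulrA.
apply: lt_le_trans dK.
have -> : d * (`|u0| + `|v0| + 1) = d * `|v0| + (`|u0| + 1) * d by ring.
apply: ler_ltD; first by rewrite ler_wpM2r // ltW.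
apply: le_lt_trans (ler_wpM2r _ hu') _ => //.
by rewrite ltr_pM2l // ltr_pwDr.
Qed.

Lemma is_diff_bil U V W X (B : U -> V -> W) (f df : X -> U) (g dg : X -> V) (x : X) :
  bounded_bilinear B -> is_diff x f df -> is_diff x g dg ->
  is_diff x (fun y => B (f y) (g y)) (fun h => B (f x) (dg h) + B (df h) (g x)).
Proof.
move=> bB fdf gdg.
have Bbil : bilinear_for (GRing.Scale.Law.clone _ _ *:%R _)
    (GRing.Scale.Law.clone _ _ *:%R _) B.
  by split=> [u'|u] a y z /=; [exact: bil_linl bB _ _ _ _ | exact: bil_linr bB _ _ _ _].
pose BM := bilinear_isBilinear.Build R U V W _ _ B Bbil.
pose BB : {bilinear U -> V -> W} := HB.pack B BM.
have cB : continuous (fun p : U * V => BB p.1 p.2) := bil_continuous bB.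
have Bdiff : is_diff (f x, g x) (fun p => BB p.1 p.2)
    (fun q => BB (f x) q.2 + BB q.1 (g x)).
  apply: DiffDef; first exact: differentiable_bilin.
  exact: diff_bilin.
exact: (@is_diff_comp R X (U * V)%type W (fun y => (f y, g y))
  (fun y => (df y, dg y)) (fun p => BB p.1 p.2) _ x).
Qed.

(** The difference [g - f] vanishes near [x], so it is differentiable there with zero differential,
    and [g = f + (g - f)]. *)
Lemma is_diff_near V W (f g df : V -> W) (x : V) :
  (\forall y \near x, f y = g y) -> is_diff x f df -> is_diff x g df.
Proof.
move=> fg fdf.
have h0 : (g - f) \o shift x = cst ((g - f) x) + (\0 : V -> W) +o_ 0 id.
  apply/eqaddoP => _/posnumP[e].
  have fgx : f x = g x by exact: nbhs_singleton fg.
  have fg0 : \forall h \near (0 : V), f (h + x) = g (h + x).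
    by move: fg; rewrite (near_shift 0) subr0.
  near=> h.
  have -> : ((g - f) \o shift x - (cst ((g - f) x) + (\0 : V -> W))) h = 0.
    rewrite !fctE /= fgx subrr addr0 subr0.
    suff -> : f (h + x) = g (h + x) by rewrite subrr.
    by near: h.
  by rewrite normr0 mulr_ge0.
have hd : is_diff x (g - f) 0.
  have cz : continuous (\0 : V -> W) by move=> ?; exact: cvg_cst.
  have d0 : 'd (g - f) x = (\0 : V -> W) :> (V -> W) by exact: diff_unique.
  apply: DiffDef => //; apply/diff_locallyP; rewrite d0; split => //.
have -> : g = f + (g - f) by rewrite addrC subrK.
rewrite -[df]addr0; exact: is_diffD.
Unshelve. all: by end_near. Qed.

Lemma Ck_onW V W k (D : set V) (f : V -> W) : Ck_on k.+1 D f -> Ck_on k D f.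
Proof.
elim: k f => [|k IH] f /= [df dfk].
  by move=> x Dx; apply: differentiable_continuous; exact: df.
by split=> // v; apply: IH; exact: dfk.
Qed.

(** Openness turns equality on [D] into equality near each point of [D]; the differentials then
    agree on [D] and the induction goes on with them. *)
Lemma Ck_on_ext V W k (D : set V) (f g : V -> W) : open D ->
  (forall x, D x -> f x = g x) -> Ck_on k D f -> Ck_on k D g.
Proof.
move=> oD; elim: k f g => [|k IH] f g fg /=.
  move=> cf x Dx; rewrite /prop_for /continuous_at -fg //.
  apply: cvg_trans (cf x Dx); apply: near_eq_cvg.
  by near=> y; apply: fg; near: y; exact: open_nbhs_nbhs.
move=> [df dfk].
have dg x : D x -> is_diff x g ('d f x).
  move=> Dx; apply: is_diff_near (differentiableP (df x Dx)).
  by near=> y; apply: fg; near: y; exact: open_nbhs_nbhs.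
split=> [x Dx|v]; first by have := dg x Dx => ?.
apply: IH (dfk v) => x Dx.
by rewrite (@diff_val _ _ _ _ _ _ _ (dg x Dx)).
Unshelve. all: by end_near. Qed.

(** Lets an explicit candidate [df] stand for the differential, so that the closure properties below
    follow by induction from the rules of differentiation. *)
Lemma Ck_onS V W k (D : set V) (f : V -> W) (df : V -> V -> W) : open D ->
  (forall x, D x -> is_diff x f (df x)) -> (forall v, Ck_on k D (df ^~ v)) ->
  Ck_on k.+1 D f.
Proof.
move=> oD fdf Cdf; split=> [x Dx|v]; first by have := fdf x Dx => ?.
apply: Ck_on_ext (Cdf v) => // x Dx.
by rewrite (@diff_val _ _ _ _ _ _ _ (fdf x Dx)).
Qed.

Lemma Ck_on_diff V W k (D : set V) (f : V -> W) x : D x ->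
  Ck_on k.+1 D f -> is_diff x f ('d f x).
Proof. by move=> Dx [df _]; exact: differentiableP (df x Dx). Qed.

Lemma Ck_on_cst V W k (D : set V) (w : W) : open D -> Ck_on k D (cst w).
Proof.
move=> oD; elim: k w => [|k IH] w; first by move=> x _; exact: cvg_cst.
apply: (@Ck_onS _ _ _ _ _ (fun _ _ => 0)) => // v; exact: IH.
Qed.

Lemma Ck_on_bl U V W k (D : set U) (L : V -> W) (f : U -> V) : open D ->
  bounded_linear L -> Ck_on k D f -> Ck_on k D (L \o f).
Proof.
move=> oD bL; elim: k f => [|k IH] f.
  move=> cf x Dx; apply: continuous_comp; first exact: cf.
  apply: differentiable_continuous.
  by have := is_diff_bl bL (is_diff_id (f x)) => ?.
move=> [df dfk].
apply: (@Ck_onS _ _ _ _ _ (fun x => L \o 'd f x)) => // [x Dx|v].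
  exact: is_diff_bl (differentiableP (df x Dx)).
exact: (IH (fun x => 'd f x v) (dfk v)).
Qed.

Lemma Ck_on_id V k (D : set V) : open D -> Ck_on k D id.
Proof.
move=> oD; case: k => [|k]; first by move=> x _; exact: cvg_id.
by apply: (@Ck_onS _ _ _ _ _ (fun _ => id)) => // v; exact: Ck_on_cst.
Qed.

Lemma Ck_onD V W k (D : set V) (f g : V -> W) : open D ->
  Ck_on k D f -> Ck_on k D g -> Ck_on k D (fun x => f x + g x).
Proof.
move=> oD; elim: k f g => [|k IH] f g.
  by move=> cf cg x Dx; apply: cvgD; [exact: cf | exact: cg].
move=> Cf Cg.
apply: (@Ck_onS _ _ _ _ _ (fun x h => 'd f x h + 'd g x h)) => // [x Dx|v].
  exact: (is_diffD (Ck_on_diff Dx Cf) (Ck_on_diff Dx Cg)).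
have [[_ Cf'] [_ Cg']] := (Cf, Cg).
exact: (IH (fun x => 'd f x v) (fun x => 'd g x v) (Cf' v) (Cg' v)).
Qed.

(** By the Leibniz rule each directional derivative is a sum of two terms of the same shape; the
    undifferentiated factor loses one order of smoothness to match the induction hypothesis. *)
Lemma Ck_on_bil U V W X k (D : set X) (B : U -> V -> W) f g : open D ->
  bounded_bilinear B -> Ck_on k D f -> Ck_on k D g ->
  Ck_on k D (fun x => B (f x) (g x)).
Proof.
move=> oD bB; elim: k f g => [|k IH] f g.
  move=> cf cg x Dx.
  have cB : {for (f x, g x), continuous (fun p : U * V => B p.1 p.2)}.
    exact: bil_continuous.
  apply: (@continuous_comp X (U * V)%type W (fun x => (f x, g x)) (fun p => B p.1 p.2) x) => //.
  by apply: cvg_pair; [exact: cf | exact: cg].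
move=> Cf Cg.
apply: (@Ck_onS _ _ _ _ _ (fun x h => B (f x) ('d g x h) + B ('d f x h) (g x))) => //.
  by move=> x Dx; exact: (is_diff_bil bB (Ck_on_diff Dx Cf) (Ck_on_diff Dx Cg)).
have [[_ Cf'] [_ Cg']] := (Cf, Cg) => v; apply: Ck_onD => //.
  exact: (IH f (fun x => 'd g x v) (Ck_onW Cf) (Cg' v)).
exact: (IH (fun x => 'd f x v) g (Cf' v) (Ck_onW Cg)).
Qed.

Lemma Ck_on_sum (I : Type) (r : seq I) V W k (D : set V) (f : I -> V -> W) : open D ->
  (forall i, Ck_on k D (f i)) -> Ck_on k D (fun x => \sum_(i <- r) f i x).
Proof.
move=> oD Cf; elim: r => [|i r IH].
  by apply: Ck_on_ext (@Ck_on_cst V W k D 0 oD) => // x _; rewrite big_nil.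
apply: Ck_on_ext (Ck_onD oD (Cf i) IH) => // x _.
by rewrite big_cons.
Qed.

End Calculus.

(** * Matrices *)

Section MatAlgebra.
Variables (R : realType) (K : scalars).
Local Notation mat := (mat R K).
Implicit Types a : R.

Lemma mmulA m n p q (A : mat m n) (B : mat n p) (C : mat p q) :
  A ** (B ** C) = A ** B ** C.
Proof. exact: mulmxA. Qed.

Lemma mmulDl m n p (A B : mat m n) (C : mat n p) : (A + B) ** C = A ** C + B ** C.
Proof. exact: mulmxDl. Qed.

Lemma mmulDr m n p (A : mat m n) (B C : mat n p) : A ** (B + C) = A ** B + A ** C.
Proof. exact: mulmxDr. Qed.

Lemma mmulNl m n p (A : mat m n) (B : mat n p) : (- A) ** B = - (A ** B).
Proof. exact: mulNmx. Qed.

Lemma mmulNr m n p (A : mat m n) (B : mat n p) : A ** (- B) = - (A ** B).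
Proof. exact: mulmxN. Qed.

Lemma mmulZl m n p a (A : mat m n) (B : mat n p) : (a *: A) ** B = a *: (A ** B).
Proof. exact/esym/scalemxAl. Qed.

Lemma mmulZr m n p a (A : mat m n) (B : mat n p) : A ** (a *: B) = a *: (A ** B).
Proof. exact/esym/scalemxAr. Qed.

Lemma mmul0l m n p (A : mat n p) : (0 : mat m n) ** A = 0.
Proof. exact: mul0mx. Qed.

Lemma mmul0r m n p (A : mat m n) : A ** (0 : mat n p) = 0.
Proof. exact: mulmx0. Qed.

Lemma mmul1l m n (A : mat m n) : mid m ** A = A.
Proof. exact: mul1mx. Qed.

Lemma mmul1r m n (A : mat m n) : A ** mid n = A.
Proof. exact: mulmx1. Qed.

Lemma conjKD : {morph @conjK R K : x y / x + y}.
Proof. by case: K => // x y; rewrite /= rmorphD. Qed.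

Lemma conjKM : {morph @conjK R K : x y / x * y}.
Proof. by case: K => // x y; rewrite /= rmorphM. Qed.

Lemma conjK0 : @conjK R K 0 = 0.
Proof. by apply: (addrI (conjK 0)); rewrite -conjKD !addr0. Qed.

Lemma conjKN (x : scal R K) : conjK (- x) = - conjK x.
Proof. by apply/eqP; rewrite -addr_eq0 -conjKD addNr conjK0. Qed.

Lemma conjK1 : @conjK R K 1 = 1.
Proof. by case: K => //=; rewrite oppr0. Qed.

Lemma conjKr a : conjK (ofR K a) = ofR K a.
Proof. by case: K => //=; rewrite oppr0. Qed.

Lemma conjKK : involutive (@conjK R K).
Proof. by case: K => // x; rewrite /= conjcK. Qed.

Lemma reKD : {morph @reK R K : x y / x + y}.
Proof. by case: K => // -[? ?] [? ?]. Qed.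

Lemma reKZ a (x : scal R K) : reK (ofR K a * x) = a * reK x.
Proof. by case: K x => // -[x y] /=; rewrite mul0r subr0. Qed.

Lemma reK0 : @reK R K 0 = 0.
Proof. by case: K. Qed.

Lemma reK_conj (x : scal R K) : reK (conjK x) = reK x.
Proof. by case: K x => // -[]. Qed.

Lemma adjD m n (A B : mat m n) : (A + B)^t = A^t + B^t.
Proof. by apply/matrixP => i j; rewrite !mxE conjKD. Qed.

Lemma adjN m n (A : mat m n) : (- A)^t = - A^t.
Proof. by apply/matrixP => i j; rewrite !mxE conjKN. Qed.

Lemma adjZ m n a (A : mat m n) : (a *: A)^t = a *: A^t.
Proof. by apply/matrixP => i j; rewrite !mxE conjKM conjKr. Qed.

Lemma adj0 m n : (0 : mat m n)^t = 0.
Proof. by apply/matrixP => i j; rewrite !mxE conjK0. Qed.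

Lemma adjK m n (A : mat m n) : (A^t)^t = A.
Proof. by apply/matrixP => i j; rewrite !mxE conjKK. Qed.

Lemma adj1 n : (mid n : mat n n)^t = mid n.
Proof.
apply/matrixP => i j; rewrite !mxE eq_sym; case: eqP => _; rewrite ?mulr1n ?mulr0n.
  exact: conjK1.
exact: conjK0.
Qed.

Lemma adjM m n p (A : mat m n) (B : mat n p) : (A ** B)^t = B^t ** A^t.
Proof.
apply/matrixP => i j; rewrite !mxE (big_morph _ conjKD conjK0).
by apply: eq_bigr => k _; rewrite !mxE conjKM mulrC.
Qed.

Lemma trRD n (A B : mat n n) : trR (A + B) = trR A + trR B.
Proof. by rewrite /trR -reKD -mxtraceD. Qed.

Lemma trRZ n a (A : mat n n) : trR (a *: A) = a * trR A.
Proof. by rewrite /trR -reKZ -mxtraceZ. Qed.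

Lemma trRN n (A : mat n n) : trR (- A) = - trR A.
Proof. by rewrite -scaleN1r trRZ mulN1r. Qed.

Lemma trRC m n (A : mat m n) (B : mat n m) : trR (A ** B) = trR (B ** A).
Proof. by rewrite /trR mxtrace_mulC. Qed.

Lemma trR_adj n (A : mat n n) : trR A^t = trR A.
Proof.
rewrite /trR -[RHS]reK_conj /mxtrace (big_morph _ conjKD conjK0); congr reK.
by apply: eq_bigr => i _; rewrite !mxE.
Qed.

(** The trace is the sum of the squared moduli of the entries. Nondegeneracy of the metric rests on
    this. *)
Lemma trR_sqr_eq0 m n (A : mat m n) : trR (A^t ** A) = 0 -> A = 0.
Proof.
have sq (x : scal R K) : 0 <= reK (conjK x * x) /\ (reK (conjK x * x) = 0 -> x = 0).
  case: K x => /= [x|[x y]] /=; rewrite ?mulNr ?opprK.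
    by rewrite -expr2 sqr_ge0; split=> // /eqP; rewrite sqrf_eq0 => /eqP.
  rewrite -!expr2 addr_ge0 ?sqr_ge0 //; split=> // /eqP.
  by rewrite paddr_eq0 ?sqr_ge0 // !sqrf_eq0 => /andP[/eqP-> /eqP->].
have -> : trR (A^t ** A) = \sum_i \sum_j reK (conjK (A j i) * A j i).
  rewrite /trR /mxtrace (big_morph _ reKD reK0); apply: eq_bigr => i _.
  rewrite !mxE (big_morph _ reKD reK0); apply: eq_bigr => j _.
  by rewrite !mxE.
move=> A0; apply/matrixP => j i; rewrite [RHS]mxE; apply: (sq _).2.
have p0 k l : 0 <= reK (conjK (A k l) * A k l) := (sq _).1.
have s0 k : true -> 0 <= \sum_l reK (conjK (A l k) * A l k).
  by move=> _; exact: sumr_ge0.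
exact: (psumr_eq0P (fun k _ => p0 k i) (psumr_eq0P s0 A0 isT)).
Qed.

Lemma mblock_col m1 m2 n1 n2 p (A : mat m1 n1) (B : mat m1 n2) (C : mat m2 n1)
    (D : mat m2 n2) (U : mat n1 p) (L : mat n2 p) :
  mblock A B C D ** mcol U L = mcol (A ** U + B ** L) (C ** U + D ** L).
Proof. exact: mul_block_col. Qed.

Lemma mrow_block m n1 n2 p1 p2 (U : mat m n1) (L : mat m n2) (A : mat n1 p1)
    (B : mat n1 p2) (C : mat n2 p1) (D : mat n2 p2) :
  mrow U L ** mblock A B C D = mrow (U ** A + L ** C) (U ** B + L ** D).
Proof. exact: mul_row_block. Qed.

Lemma mrow_col m n1 n2 p (A : mat m n1) (B : mat m n2) (C : mat n1 p) (D : mat n2 p) :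
  mrow A B ** mcol C D = A ** C + B ** D.
Proof. exact: mul_row_col. Qed.

Lemma mblockM m1 m2 n1 n2 p1 p2 (A : mat m1 n1) (B : mat m1 n2) (C : mat m2 n1)
    (D : mat m2 n2) (E : mat n1 p1) (F : mat n1 p2) (G : mat n2 p1) (H : mat n2 p2) :
  mblock A B C D ** mblock E F G H =
  mblock (A ** E + B ** G) (A ** F + B ** H) (C ** E + D ** G) (C ** F + D ** H).
Proof. exact: mulmx_block. Qed.

Lemma mblockD m1 m2 n1 n2 (A E : mat m1 n1) (B F : mat m1 n2) (C G : mat m2 n1)
    (D H : mat m2 n2) :
  mblock A B C D + mblock E F G H = mblock (A + E) (B + F) (C + G) (D + H).
Proof. exact: add_block_mx. Qed.

Lemma adj_mblock m1 m2 n1 n2 (A : mat m1 n1) (B : mat m1 n2) (C : mat m2 n1)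
    (D : mat m2 n2) : (mblock A B C D)^t = mblock A^t C^t B^t D^t.
Proof. by rewrite /adj /mblock tr_block_mx map_block_mx. Qed.

Lemma adj_mrow m n1 n2 (A : mat m n1) (B : mat m n2) : (mrow A B)^t = mcol A^t B^t.
Proof. by rewrite /adj /mrow /mcol tr_row_mx map_col_mx. Qed.

Lemma mcol_row m1 m2 n p1 p2 (A : mat m1 n) (B : mat m2 n) (C : mat n p1) (D : mat n p2) :
  mcol A B ** mrow C D = mblock (A ** C) (A ** D) (B ** C) (B ** D).
Proof. exact: mul_col_row. Qed.

End MatAlgebra.

(** * Real coordinates of matrices *)

Section MatCoordinates.
Variables (R : realType) (K : scalars).
Local Notation mat := (mat R K).
Implicit Types a : R.

Definition imK : scal R K -> R :=
  match K return scal R K -> R with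
  | RealScalars => fun=> 0 | ComplexScalars => @complex.Im R end.

(* over the reals the second half of the family [mat_basis] is zero *)
Definition unitK : bool -> scal R K :=
  match K return bool -> scal R K with
  | RealScalars => fun b => if b then 0 else 1
  | ComplexScalars => fun b => if b then Complex 0 1 else 1 end.

(** The boolean selects the imaginary part, so that one index type serves both scalar fields and
    [mat_decomp] has a single form. *)
Definition mat_coord m n (t : 'I_m * 'I_n * bool) (A : mat m n) : R :=
  let x := A t.1.1 t.1.2 in if t.2 then imK x else reK x.

Definition mat_basis m n (t : 'I_m * 'I_n * bool) : mat m n :=
  unitK t.2 *: (delta_mx t.1.1 t.1.2 : 'M[scal R K]_(m, n)).

Lemma scal_decomp (x : scal R K) :
  x = ofR K (reK x) * unitK false + ofR K (imK x) * unitK true.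
Proof.
rewrite /unitK /imK; case: K x => /= [x|[x y]]; first by rewrite mulr1 mulr0 addr0.
by apply/eqP; rewrite eq_complex /=; apply/andP; split; apply/eqP; ring.
Qed.

Lemma imK_linear a (x y : scal R K) : imK (ofR K a * x + y) = a * imK x + imK y.
Proof.
rewrite /imK; case: K x y => /= [x y|[x1 x2] [y1 y2] /=]; first by rewrite mulr0 addr0.
by rewrite mul0r addr0.
Qed.

Lemma mat_coord_linear m n (t : 'I_m * 'I_n * bool) : linear (mat_coord t : _ -> R^o).
Proof.
move=> a A B; rewrite /mat_coord !mxE; case: t.2; first exact: imK_linear.
by rewrite reKD reKZ.
Qed.

Lemma mat_coord_le m n (t : 'I_m * 'I_n * bool) (A : mat m n) : `|mat_coord t A| <= `|A|.
Proof.
apply: le_trans (_ : absK (A t.1.1 t.1.2) <= _).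
  rewrite /mat_coord /imK /reK /absK; case: t => -[i j] /= b.
  move: (A i j) => {A}; case: K => [x|[x y]] /=; case: b; rewrite /= ?normr0 //.
  - by rewrite -sqrtr_sqr ler_wsqrtr // lerDr sqr_ge0.
  - by rewrite -sqrtr_sqr ler_wsqrtr // lerDl sqr_ge0.
rewrite [`|A|]/(mat_norm A) /mat_norm (bigD1 t.1.1) //= (bigD1 t.1.2) //= -addrA lerDl.
by rewrite addr_ge0 ?sumr_ge0 // => i _; rewrite ?absK_ge0 // sumr_ge0 // => j _; rewrite absK_ge0.
Qed.

Lemma mat_decomp m n (A : mat m n) : A = \sum_t mat_coord t A *: mat_basis t.
Proof.
transitivity (\sum_(p : 'I_m * 'I_n) \sum_(b : bool)
    mat_coord (p, b) A *: mat_basis (p, b)); last first.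
  by rewrite pair_bigA; apply: eq_bigr => -[].
transitivity (\sum_i \sum_j A i j *: (delta_mx i j : 'M[scal R K]_(m, n))).
  exact: matrix_sum_delta.
rewrite pair_bigA; apply: eq_bigr => -[i j] _ /=.
rewrite big_bool /= addrC {1}[A i j]scal_decomp scalerDl.
by congr (_ + _); rewrite -scalerA.
Qed.

Lemma mat_coordP m n (A B : mat m n) :
  (forall t, mat_coord t A = mat_coord t B) -> A = B.
Proof.
by move=> AB; rewrite (mat_decomp A) (mat_decomp B); apply: eq_bigr => t _; rewrite AB.
Qed.

(** Finite dimension makes continuity automatic: expand on [mat_basis] and take the sum of the norms
    of the images as constant. *)
Lemma mat_bounded_linear m n (V : normedModType R) (f : mat m n -> V) :
  linear f -> bounded_linear f.
Proof.
move=> fl; split=> //; exists (\sum_t `|f (mat_basis t)|) => A.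
rewrite {1}(mat_decomp A) (linear_sumZ fl) mulr_suml.
apply: le_trans (ler_norm_sum _ _ _) _; apply: ler_sum => t _.
by rewrite normrZ mulrC ler_wpM2l // mat_coord_le.
Qed.

Lemma mat_bounded_bilinear m n p q (W : normedModType R) (B : mat m n -> mat p q -> W) :
  (forall v, linear (B ^~ v)) -> (forall u, linear (B u)) -> bounded_bilinear B.
Proof.
move=> Bl Br; split=> //.
exists (\sum_s \sum_t `|B (mat_basis s) (mat_basis t)|) => u v.
rewrite {1}(mat_decomp u) (linear_sumZ (Bl v)) !mulr_suml.
apply: le_trans (ler_norm_sum _ _ _) _; apply: ler_sum => s _.
rewrite {1}(mat_decomp v) (linear_sumZ (Br _)) !mulr_suml scaler_sumr.
apply: le_trans (ler_norm_sum _ _ _) _; apply: ler_sum => t _.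
rewrite scalerA normrZ normrM mulrC -mulrA ler_wpM2l //.
by apply: ler_pM => //; exact: mat_coord_le.
Qed.

End MatCoordinates.

(** * Derivatives of curves in a normed space *)

Section CurveDerivative.
Variable R : realType.
Implicit Types U V W : normedModType R.

(* the domain is [R^o], as in [smooth_on] *)
Definition has_deriv V (f : R -> V) (t : R) (v : V) :=
  is_diff (t : R^o) (f : R^o -> V) (fun h : R^o => (h : R) *: v).

Lemma has_deriv_derive1 V (f : R -> V) t v : has_deriv f t v -> derive1 f t = v.
Proof. by move=> [df dv]; rewrite derive1E' // dv scale1r. Qed.

Lemma has_derivP V (f : R -> V) t :
  differentiable (f : R^o -> V) (t : R^o) -> has_deriv f t (derive1 f t).
Proof. by move=> df; apply: DiffDef => //; exact: diff1E. Qed.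

Lemma has_deriv_near V (f g : R -> V) t v :
  (\forall s \near t, f s = g s) -> has_deriv f t v -> has_deriv g t v.
Proof. exact: is_diff_near. Qed.

Lemma has_deriv_eq V (f : R -> V) t v w : has_deriv f t v -> v = w -> has_deriv f t w.
Proof. by move=> ? <-. Qed.

Lemma has_deriv_bl V W (L : V -> W) (f : R -> V) t v :
  bounded_linear L -> has_deriv f t v -> has_deriv (L \o f) t (L v).
Proof.
move=> bL fv; rewrite /has_deriv.
have -> : (fun h : R^o => (h : R) *: L v) = L \o (fun h : R^o => (h : R) *: v).
  by apply/funext => h /=; rewrite (linear_funZ (bl_linear bL)).
exact: (is_diff_bl bL fv).
Qed.

Lemma has_deriv_comp V W (F dF : V -> W) (f : R -> V) t v :
  (forall (a : R) u, dF (a *: u) = a *: dF u) -> is_diff (f t) F dF -> has_deriv f t v ->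
  has_deriv (F \o f) t (dF v).
Proof.
move=> dFZ FdF fv; rewrite /has_deriv.
have -> : (fun h : R^o => (h : R) *: dF v) = dF \o (fun h : R^o => (h : R) *: v).
  by apply/funext => h /=; rewrite dFZ.
exact: is_diff_comp.
Qed.

Lemma has_deriv_diff V W (F : V -> W) (f : R -> V) t v :
  differentiable F (f t) -> has_deriv f t v -> has_deriv (F \o f) t ('d F (f t) v).
Proof.
move=> dF; apply: has_deriv_comp; first by move=> a x; rewrite linearZ.
exact: differentiableP.
Qed.

Lemma has_deriv_bil U V W (B : U -> V -> W) (f : R -> U) (g : R -> V) t u v :
  bounded_bilinear B -> has_deriv f t u -> has_deriv g t v ->
  has_deriv (fun s => B (f s) (g s)) t (B (f t) v + B u (g t)).
Proof.
move=> bB fu gv; rewrite /has_deriv.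
have BZl a x y : B (a *: x) y = a *: B x y.
  exact: (linear_funZ (bil_linl bB y)).
have BZr a x y : B x (a *: y) = a *: B x y := linear_funZ (bil_linr bB x) a y.
have -> : (fun h : R^o => (h : R) *: (B (f t) v + B u (g t))) =
   (fun h : R^o => B (f t) ((h : R) *: v) + B ((h : R) *: u) (g t)).
  by apply/funext => h; rewrite scalerDr BZl BZr.
exact: (is_diff_bil bB fu gv).
Qed.

Lemma has_deriv_cst V (w : V) t : has_deriv (fun=> w) t 0.
Proof.
rewrite /has_deriv; have -> : (fun h : R^o => (h : R) *: (0 : V)) = 0.
  by apply/funext => h; rewrite scaler0.
exact: (@is_diff_cst R R^o V w t).
Qed.

Lemma has_derivD V (f g : R -> V) t v w : has_deriv f t v -> has_deriv g t w ->
  has_deriv (fun s => f s + g s) t (v + w).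
Proof.
move=> fv gw; rewrite /has_deriv.
have -> : (fun h : R^o => (h : R) *: (v + w)) =
    (fun h : R^o => (h : R) *: v) + (fun h : R^o => (h : R) *: w).
  by apply/funext => h; rewrite scalerDr.
exact: (is_diffD fv gw).
Qed.

Lemma has_deriv_sum V (I : Type) (r : seq I) (f : I -> R -> V) t (v : I -> V) :
  (forall i, has_deriv (f i) t (v i)) ->
  has_deriv (fun s => \sum_(i <- r) f i s) t (\sum_(i <- r) v i).
Proof.
move=> fv; elim: r => [|i r IH].
  rewrite big_nil; apply: has_deriv_near (has_deriv_cst _ _).
  by near=> s; rewrite big_nil.
rewrite big_cons; apply: has_deriv_near (has_derivD (fv i) IH).
by near=> s; rewrite big_cons.
Unshelve. all: by end_near. Qed.

(** Bridge to real functions of one variable, through which the mean value theorem and the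
    differentiation of power series are used. *)
Lemma has_deriv_real (f : R -> R) (t v : R) :
  has_deriv (f : R -> R^o) t v <-> is_derive t (1 : R) f v.
Proof.
split=> [fv|[fd fv]].
  have df : derivable f t 1 by apply/derivable1_diffP; exact: (@ex_diff _ _ _ _ _ _ _ fv).
  by apply: DeriveDef => //; rewrite -derive1E; exact: has_deriv_derive1 fv.
apply: has_deriv_eq (has_derivP _) _; last by rewrite -fv -derive1E.
exact/derivable1_diffP.
Qed.

Lemma scale_bounded_bilinear V : bounded_bilinear (fun (a : R^o) (v : V) => (a : R) *: v).
Proof.
split=> [v a x y|x a u v|]; first by rewrite scalerDl scalerA.
  by rewrite scalerDr !scalerA mulrC.
by exists 1 => a v; rewrite mul1r normrZ.
Qed.

Lemma scale_bounded_linear V (a : R) : bounded_linear (fun v : V => a *: v).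
Proof.
split=> [b u v|]; first by rewrite scalerDr !scalerA mulrC.
by exists `|a| => u; rewrite normrZ.
Qed.

Lemma has_derivZ V a (f : R -> V) t v : has_deriv f t v ->
  has_deriv (fun s => a *: f s) t (a *: v).
Proof. exact: (has_deriv_bl (scale_bounded_linear V a)). Qed.

Lemma has_deriv_unique V (f : R -> V) t v w : has_deriv f t v -> has_deriv f t w -> v = w.
Proof. by move=> /has_deriv_derive1 <- /has_deriv_derive1. Qed.

End CurveDerivative.

(** * Curves of matrices *)

Section MatCurves.
Variables (R : realType) (K : scalars).
Local Notation mat := (mat R K).

Lemma mmul_bounded_bilinear m n p :
  bounded_bilinear (@mmul R K m n p : mat m n -> mat n p -> mat m p).
Proof.
apply: mat_bounded_bilinear => [v a x y|u a x y]; first by rewrite mmulDl mmulZl.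
by rewrite mmulDr mmulZr.
Qed.

Lemma adj_bounded_linear m n : bounded_linear (@adj R K m n).
Proof. by apply: mat_bounded_linear => a x y; rewrite adjD adjZ. Qed.

Lemma trR_bounded_linear n : bounded_linear (@trR R K n : _ -> R^o).
Proof. by apply: mat_bounded_linear => a x y; rewrite trRD trRZ. Qed.

Lemma coord_bounded_linear m n t : bounded_linear (@mat_coord R K m n t : _ -> R^o).
Proof. by apply: mat_bounded_linear; exact: mat_coord_linear. Qed.

Lemma has_deriv_mmul m n p (f : R -> mat m n) (g : R -> mat n p) t u v :
  has_deriv f t u -> has_deriv g t v ->
  has_deriv (fun s => f s ** g s) t (f t ** v + u ** g t).
Proof. exact: (has_deriv_bil (@mmul_bounded_bilinear m n p)). Qed.

Lemma has_deriv_mmull m n p (A : mat m n) (g : R -> mat n p) t v :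
  has_deriv g t v -> has_deriv (fun s => A ** g s) t (A ** v).
Proof.
move=> gv; apply: has_deriv_eq (has_deriv_mmul (has_deriv_cst A t) gv) _.
by rewrite mmul0l addr0.
Qed.

Lemma has_deriv_mmulr m n p (f : R -> mat m n) (B : mat n p) t u :
  has_deriv f t u -> has_deriv (fun s => f s ** B) t (u ** B).
Proof.
move=> fu; apply: has_deriv_eq (has_deriv_mmul fu (has_deriv_cst B t)) _.
by rewrite mmul0r add0r.
Qed.

Lemma has_deriv_adj m n (f : R -> mat m n) t u :
  has_deriv f t u -> has_deriv (fun s => (f s)^t) t u^t.
Proof. exact: (has_deriv_bl (@adj_bounded_linear m n)). Qed.

Lemma has_deriv_coord m n (f : R -> mat m n) t v :
  (forall i, has_deriv (fun s => mat_coord i (f s) : R^o) t (mat_coord i v)) ->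
  has_deriv f t v.
Proof.
move=> fv; rewrite (mat_decomp v).
have H := has_deriv_sum (index_enum _) (fun i =>
  has_deriv_bil (@scale_bounded_bilinear R (mat m n)) (fv i)
  (has_deriv_cst (mat_basis R K i) t)).
apply: has_deriv_near (has_deriv_eq H _).
  by near=> s; rewrite [RHS]mat_decomp.
by apply: eq_bigr => i _; rewrite scaler0 add0r.
Unshelve. all: by end_near. Qed.

(** The mean value theorem is applied to each real coordinate separately, as it has no vector-valued
    form. *)
Lemma has_deriv0_cst m n (I : set R) (f : R -> mat m n) s t : is_interval I -> I s -> I t ->
  (forall x, I x -> has_deriv f x 0) -> f s = f t.
Proof.
move=> Iitv Is It f0; apply: mat_coordP => i.
wlog st : s t Is It / s <= t.
  by move=> H; case: (leP s t) => [/H|/ltW /H h]; [apply | apply/esym/h].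
have f0' x : I x -> is_derive x (1 : R) (fun y => mat_coord i (f y)) 0.
  move=> Ix; apply/has_deriv_real.
  apply: has_deriv_eq (has_deriv_bl (coord_bounded_linear i) (f0 x Ix)) _.
  by rewrite /mat_coord mxE; case: ifP => _; rewrite ?reK0 // /imK; case: (K).
have Ix x : x \in `[s, t]%R -> I x.
  by rewrite in_itv /= => xst; exact: (Iitv s t).
have [x xst||x _] := @MVT_segment R (fun y => mat_coord i (f y)) (fun=> 0) s t st.
- by apply/f0'/Ix; move: xst; rewrite !in_itv /= => /andP[/ltW -> /ltW ->].
- apply: derivable_within_continuous => x /Ix Ix'.
  by have := f0' x Ix' => -[].
- by rewrite mul0r => /eqP; rewrite subr_eq0 => /eqP.
Qed.

End MatCurves.

(** * The matrix exponential *)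

Section MatrixExponential.
Variables (R : realType) (K : scalars).
Local Notation mat := (mat R K).

Definition mexp_term n (X : mat n n) (i : nat) : mat n n :=
  (i`!%:R : R)^-1 *: mpow X i.

Lemma mpowS n (X : mat n n) i : mpow X i.+1 = X ** mpow X i.
Proof. by []. Qed.

Lemma mpowZ n (X : mat n n) (t : R) i : mpow (t *: X) i = t ^+ i *: mpow X i.
Proof.
elim: i => [|i IH]; first by rewrite expr0 scale1r.
by rewrite !mpowS IH mmulZl mmulZr scalerA exprS.
Qed.

(** The norm is only known to be submultiplicative up to the constant [C] of the bilinear product,
    whence the ratio [|C| |X|]. *)
Lemma mpow_bound n (X : mat n n) :
  exists2 M, 0 <= M & forall i, `|mpow X i| <= `|mid n : mat n n| * M ^+ i.
Proof.
have [_ _ [C mC]] := mmul_bounded_bilinear R K n n n.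
exists (`|C| * `|X|) => [|i]; first by rewrite mulr_ge0.
elim: i => [|i IH]; first by rewrite expr0 mulr1.
rewrite mpowS exprS mulrCA (le_trans (mC _ _)) //.
apply: le_trans (_ : `|C| * `|X| * `|mpow X i| <= _); last by rewrite ler_wpM2l ?mulr_ge0.
by rewrite !ler_wpM2r // ler_norm.
Qed.

(** The terms are dominated by those of the real series of [exp (M |t|)]. An arbitrary [l] is
    allowed because differentiating a coordinate of the exponential yields [l (X ** _)], which is no
    longer a coordinate. *)
Lemma is_cvg_mexp_coef n (X : mat n n) (l : mat n n -> R^o) (t : R) : bounded_linear l ->
  cvgn (pseries (fun i => (i`!%:R)^-1 * l (mpow X i)) t).
Proof.
move=> [_ [D lD]]; have [M M0 XM] := mpow_bound X.
apply: normed_cvg.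
apply: (@series_le_cvg _ _ (fun i => (`|D| * `|mid n : mat n n|) * exp_coeff (M * `|t|) i)).
- by move=> i; exact: normr_ge0.
- by move=> i; apply: mulr_ge0; [exact: mulr_ge0 | exact/exp_coeff_ge0/mulr_ge0].
- move=> i /=; rewrite !normrM normfV normrX (ger0_norm (ler0n _ _)) /exp_coeff /= exprMn.
  have -> : `|D| * `|mid n : mat n n| * (M ^+ i * `|t| ^+ i / i`!%:R) =
    i`!%:R^-1 * (`|D| * (`|mid n : mat n n| * M ^+ i)) * `|t| ^+ i by ring.
  rewrite ler_wpM2r ?exprn_ge0 // ler_wpM2l ?invr_ge0 // (le_trans (lD _)) //.
  apply: le_trans (_ : `|D| * `|mpow X i| <= _); last by rewrite ler_wpM2l.
  by rewrite ler_wpM2r // ler_norm.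
exact/is_cvg_seriesZ/is_cvg_series_exp_coeff.
Qed.

Lemma mat_cvg m n (u : nat -> mat m n) (l : 'I_m * 'I_n * bool -> R) :
  (forall i, (fun k => mat_coord i (u k)) @ \oo --> l i) ->
  u @ \oo --> \sum_i l i *: mat_basis R K i.
Proof.
move=> ul.
have -> : u = (fun k => \sum_i mat_coord i (u k) *: mat_basis R K i).
  by apply/funext => k; exact: mat_decomp.
apply: cvg_big => [|i _]; first exact: add_continuous.
by apply: cvgZr_tmp; exact: ul.
Qed.

Lemma is_cvg_mexp n (X : mat n n) : cvgn (series (mexp_term X)).
Proof.
apply/cvg_ex; exists (\sum_i limn (pseries (fun k => (k`!%:R)^-1 * mat_coord i (mpow X k)) 1)
   *: mat_basis R K i).
apply: mat_cvg => i.
have -> : (fun k => mat_coord i (series (mexp_term X) k)) =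
    pseries (fun k => (k`!%:R)^-1 * mat_coord i (mpow X k)) 1.
  apply/funext => k; rewrite /pseries /series /= (linear_sumZ (@mat_coord_linear R K n n i)).
  by apply: eq_bigr => j _; rewrite expr1n mulr1.
exact: is_cvg_mexp_coef (coord_bounded_linear R K i).
Qed.

(** A bounded linear map passes through the series, so a linear identity about exponentials need
    only be checked on powers. *)
Lemma bl_mexp n (X : mat n n) (V : normedModType R) (l : mat n n -> V) :
  bounded_linear l ->
  (fun k => \sum_(0 <= i < k) (i`!%:R : R)^-1 *: l (mpow X i)) @ \oo --> l (mexp X).
Proof.
move=> bl.
have -> : (fun k => \sum_(0 <= i < k) (i`!%:R : R)^-1 *: l (mpow X i)) =
    l \o series (mexp_term X).
  apply/funext => k; rewrite /series /= (linear_sumZ (bl_linear bl)).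
  by [].
apply: continuous_cvg; last exact: is_cvg_mexp.
apply: differentiable_continuous.
by have := is_diff_bl bl (is_diff_id (mexp X)) => ?.
Qed.

Lemma bl_mexpZ n (X : mat n n) (l : mat n n -> R^o) (t : R) : bounded_linear l ->
  l (mexp (t *: X)) = limn (pseries (fun i => (i`!%:R)^-1 * l (mpow X i)) t).
Proof.
move=> bl; apply/esym/cvg_lim => //.
have := bl_mexp (X := t *: X) bl.
suff -> : (fun k => \sum_(0 <= i < k) (i`!%:R : R)^-1 *: l (mpow (t *: X) i)) =
   pseries (fun i => (i`!%:R)^-1 * l (mpow X i)) t by [].
apply/funext => k; rewrite /pseries /series /=; apply: eq_bigr => i _.
rewrite mpowZ (linear_funZ (bl_linear bl)) scalerA; exact: mulrAC.
Qed.

Lemma has_deriv_mexp n (X : mat n n) (t : R) :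
  has_deriv (fun s => mexp (s *: X)) t (X ** mexp (t *: X)).
Proof.
apply: has_deriv_coord => i.
have bi := @coord_bounded_linear R K n n i.
have bXl (l : mat n n -> R^o) : bounded_linear l -> bounded_linear (fun Y => l (X ** Y)).
  move=> bl; apply: mat_bounded_linear => a x y.
  by rewrite mmulDr mmulZr (bl_linear bl).
(* Formal differentiation shifts the index: the factor [k.+1] cancels in the factorial, and the
   extra [X] is absorbed into the functional. *)
have dE (l : mat n n -> R^o) : pseries_diffs (fun k => (k`!%:R)^-1 * l (mpow X k)) =
    (fun k => (k`!%:R)^-1 * l (X ** mpow X k)).
  apply/funext => k; rewrite /pseries_diffs factS natrM invfM -mpowS.
  by rewrite !mulrA divff ?mul1r // pnatr_eq0.
have -> : (fun s => mat_coord i (mexp (s *: X)) : R^o) =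
    (fun s => limn (pseries (fun k => (k`!%:R)^-1 * mat_coord i (mpow X k)) s)).
  by apply/funext => s; exact: bl_mexpZ.
rewrite [mat_coord i (X ** _)](bl_mexpZ _ _ (bXl _ bi)).
apply/has_deriv_real; rewrite -(dE (mat_coord i)).
(* Termwise differentiation at [t] asks for convergence of the series and of its first two formal
   derivatives at a point of larger modulus, here [|t| + 1]. *)
have := @pseries_snd_diffs R (fun k => (k`!%:R)^-1 * mat_coord i (mpow X k)) (`|t| + 1) t.
apply.
- exact: is_cvg_mexp_coef.
- by rewrite (dE (mat_coord i)); exact: is_cvg_mexp_coef (bXl _ bi).
- rewrite (dE (mat_coord i)) (dE (fun Y => mat_coord i (X ** Y))).
  exact: is_cvg_mexp_coef (bXl _ (bXl _ bi)).
- by rewrite [ltRHS]ger0_norm ?addr_ge0 // ltrDl.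
Qed.

Lemma mexp0 n : mexp (0 : mat n n) = mid n.
Proof.
apply: cvg_lim => //; apply/cvgrPdist_lt => e e0; near=> k.
suff -> : series (fun i => (i`!%:R : R)^-1 *: mpow (0 : mat n n) i) k = mid n.
  by rewrite subrr normr0.
(* The partial sum at [k = 0] is empty, hence not the identity. *)
have k0 : (0 < k)%N by near: k; exact: nbhs_infty_gt.
rewrite -(prednK k0) /series /= big_nat_recl //= fact0 invr1 scale1r big1 ?addr0 //.
by move=> i _; rewrite mmul0l scaler0.
Unshelve. all: by end_near. Qed.

(** [T] may be rectangular, which is what compares generators of sizes [p + p] and [p + k]; with [T]
    square it gives the commutation rules. *)
Lemma mexp_intertwine m n (T : mat m n) (B : mat n n) (C : mat m m) :
  T ** B = C ** T -> T ** mexp B = mexp C ** T.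
Proof.
move=> TB; have TBi i : T ** mpow B i = mpow C i ** T.
  elim: i => [|i IH]; first by rewrite /mpow /= mmul1l mmul1r.
  by rewrite !mpowS mmulA TB -mmulA IH mmulA.
have bT : bounded_linear (fun X : mat n n => T ** X).
  by apply: mat_bounded_linear => a x y; rewrite mmulDr mmulZr.
have bT' : bounded_linear (fun X : mat m m => X ** T).
  by apply: mat_bounded_linear => a x y; rewrite mmulDl mmulZl.
have /cvg_lim <- // := bl_mexp (X := B) bT; have /cvg_lim <- // := bl_mexp (X := C) bT'.
by under eq_fun do under eq_bigr do rewrite TBi.
Qed.

Lemma mexp_adj n (X : mat n n) : (mexp X)^t = mexp X^t.
Proof.
have comm Y i : Y ** mpow Y i = mpow Y i ** Y :> mat n n.
  elim: i => [|i IH]; first by rewrite /mpow /= mmul1l mmul1r.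
  by rewrite !mpowS {1}IH mmulA.
have Xi i : (mpow X i)^t = mpow X^t i.
  by elim: i => [|i IH]; [exact: adj1 | rewrite mpowS comm adjM IH].
have /cvg_lim <- // := bl_mexp (X := X) (@adj_bounded_linear R K n n).
by congr lim; under eq_fun do under eq_bigr do rewrite Xi.
Qed.

(** The product has zero derivative because [X] commutes with its exponential, and it is the
    identity at 0. *)
Lemma mexpZNM n (X : mat n n) (t : R) : mexp (t *: X) ** mexp (- t *: X) = mid n.
Proof.
have d s : has_deriv (fun s => mexp (s *: X) ** mexp (s *: - X)) s 0.
  apply: has_deriv_eq (has_deriv_mmul (has_deriv_mexp X s) (has_deriv_mexp (- X) s)) _.
  have -> : X ** mexp (s *: X) = mexp (s *: X) ** X.
    by apply: mexp_intertwine; rewrite mmulZl mmulZr.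
  by rewrite mmulNl mmulNr -!mmulA addNr.
rewrite scaleNr -scalerN (@has_deriv0_cst _ _ _ _ setT _ t 0 _ _ _ (fun s _ => d s)) //.
by rewrite !scale0r mexp0 mmul1l.
Qed.

End MatrixExponential.

Section CoordinateRules.
Variables (R : realType) (K : scalars) (m n : nat) (i : 'I_m * 'I_n * bool).
Implicit Types A B : mat R K m n.

Lemma mat_coordD A B : mat_coord i (A + B) = mat_coord i A + mat_coord i B.
Proof. exact: linear_funD (@mat_coord_linear R K m n i) A B. Qed.

Lemma mat_coordZ a A : mat_coord i (a *: A) = a * mat_coord i A.
Proof. exact: linear_funZ (@mat_coord_linear R K m n i) a A. Qed.

Lemma mat_coordN A : mat_coord i (- A) = - mat_coord i A.
Proof. by rewrite -scaleN1r mat_coordZ mulN1r. Qed.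

Lemma mat_coord0 : mat_coord i (0 : mat R K m n) = 0.
Proof. exact: linear_fun0 (@mat_coord_linear R K m n i). Qed.

End CoordinateRules.

Ltac mat_expand := rewrite ?(mmulDl, mmulDr, mmulNl, mmulNr, mmulZl, mmulZr, mmul0l,
  mmul0r, mmul1l, mmul1r, adjD, adjN, adjZ, adjM, adjK, adj0, adj1, mmulA).

(* an identity between linear combinations of the same matrices is checked
   coordinatewise over the reals; the products are generalized first, because
   unification would unfold them *)
Ltac mat_lin :=
  repeat match goal with |- context [@mmul ?R ?K ?m ?n ?p ?A ?B] =>
    generalize (@mmul R K m n p A B); intro end;
  apply: mat_coordP => ?;
  rewrite ?(mat_coordD, mat_coordN, mat_coordZ, mat_coord0);
  repeat match goal with |- context [@mat_coord ?R ?K ?m ?n ?i ?X] =>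
    generalize (@mat_coord R K m n i X); intro end;
  by field.

(** Writes a block row with products and sums only, so that the rules for [has_deriv] apply to
    it. *)
Lemma mrowE (R : realType) (K : scalars) m n1 n2 (U : mat R K m n1) (V : mat R K m n2) :
  mrow U V = U ** mrow (mid n1) 0 + V ** mrow 0 (mid n2).
Proof.
rewrite /mrow /mmul !mul_mx_row !mulmx1 !mulmx0.
by rewrite [RHS]add_row_mx addr0 add0r.
Qed.

(** * Linear systems with constant coefficients *)

Section LinearSystem.
Variables (R : realType) (K : scalars).
Local Notation mat := (mat R K).

Lemma mexp_comm n (X : mat n n) (t : R) : X ** mexp (t *: X) = mexp (t *: X) ** X.
Proof. by apply: mexp_intertwine; rewrite mmulZl mmulZr. Qed.

Lemma mexpNZM n (X : mat n n) (t : R) : mexp (t *: - X) ** mexp (t *: X) = mid n.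
Proof. by have := mexpZNM (- X) t; rewrite scaleNr -scalerN opprK. Qed.

Lemma mexpZNM' n (X : mat n n) (t : R) : mexp (t *: X) ** mexp (t *: - X) = mid n.
Proof. by rewrite scalerN -scaleNr mexpZNM. Qed.

(** Integrating factor: [F t ** mexp (- t B)] has zero derivative. *)
Lemma linear_ode_unique m n (I : set R) (F : R -> mat m n) (B : mat n n) :
  is_interval I -> I 0 -> (forall t, I t -> has_deriv F t (F t ** B)) ->
  forall t, I t -> F t = F 0 ** mexp (t *: B).
Proof.
move=> Iitv I0 dF t It.
have dG s : I s -> has_deriv (fun s => F s ** mexp (s *: - B)) s 0.
  move=> Is; apply: has_deriv_eq (has_deriv_mmul (dF s Is) (has_deriv_mexp (- B) s)) _.
  have -> : - B ** mexp (s *: - B) = - (B ** mexp (s *: - B)) by rewrite mmulNl.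
  by rewrite mmulNr -!mmulA addNr.
have := has_deriv0_cst Iitv It I0 dG; rewrite scale0r mexp0 mmul1r => <-.
by rewrite -mmulA mexpNZM mmul1r.
Qed.

(** The derivative is a bounded linear function of the curve itself, so smoothness of order [k]
    gives order [k.+1]. *)
Lemma smooth_mexp n (X : mat n n) (D : set R) : open D ->
  smooth_on (D : set R^o) (fun t : R^o => mexp ((t : R) *: X)).
Proof.
move=> oD k; elim: k => [|k IH].
  move=> t _; apply: differentiable_continuous.
  exact: (@ex_diff _ _ _ _ _ _ _ (has_deriv_mexp X t)).
apply: (Ck_onS oD (fun t _ => has_deriv_mexp X t)) => v.
have bl : bounded_linear (fun Y : mat n n => (v : R) *: (X ** Y)).
  by apply: mat_bounded_linear => a x y; mat_expand; mat_lin.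
exact: (Ck_on_bl oD bl IH).
Qed.

End LinearSystem.

(** * The linear system of a geodesic *)

Lemma stiefel_skew (R : realType) (K : scalars) n p (Y v : mat R K n p) :
  stiefel_tangent Y v -> v^t ** Y = - (Y^t ** v).
Proof. by move=> H; apply/eqP; rewrite -addr_eq0 addrC; exact/eqP. Qed.

Section StiefelSystem.
Variables (R : realType) (K : scalars) (n p : nat) (alpha : R).
Local Notation mat := (mat R K).
Variables (Y0 eta : mat n p) (A S0 : mat p p).
Hypothesis Y0St : stiefel Y0.
Hypothesis etaT : stiefel_tangent Y0 eta.
Hypothesis defA : Y0^t ** eta = A.
Hypothesis defS0 : eta^t ** eta = S0.
Local Notation c := (2 * alpha - 1).
Local Notation D := ((2 * (alpha - 1)) *: (A ** A) - S0).
Local Notation B := (mblock (c *: A) D (mid p) A).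

Definition stiefel_exp_curve (t : R) : mat n p :=
  mrow Y0 eta ** mexp (t *: B) ** mcol (mexp (((1 - 2 * alpha) * t) *: A)) 0.

Lemma stiefel_exp_skew : A^t = - A.
Proof. by rewrite -defA adjM adjK stiefel_skew. Qed.
Local Notation Askew := stiefel_exp_skew.

Lemma stiefel_exp_herm : S0^t = S0.
Proof. by rewrite -defS0 adjM adjK. Qed.
Local Notation S0h := stiefel_exp_herm.

Local Notation G0 := (mblock (mid p) A (- A) S0).

(** [G0] is the Gram matrix of [[Y0 eta]]. The identity says that [B] is skew-adjoint for the form
    [G0], so that its exponential preserves this form. *)
Lemma stiefel_gram_invariant : G0 ** B + B^t ** G0 = 0.
Proof.
have -> : 0 = mblock 0 0 0 0 :> mat (p + p) (p + p) by rewrite /mblock block_mx0.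
rewrite adj_mblock !mblockM mblockD; mat_expand; rewrite Askew S0h.
congr mblock; mat_expand; mat_lin.
Qed.

(* the Gram matrix [F^t ** F] of the solution [F = [Z W]] is a first integral *)
Lemma stiefel_system : exists Z W : R -> mat n p,
  [/\ forall t, stiefel_exp_curve t = Z t ** mexp (t *: - (c *: A)),
      forall t, has_deriv Z t (c *: (Z t ** A) + W t),
      forall t, has_deriv W t
        ((2 * (alpha - 1)) *: (Z t ** A ** A) - Z t ** S0 + W t ** A),
      Z 0 = Y0 /\ W 0 = eta &
      forall t, [/\ (Z t)^t ** Z t = mid p, (Z t)^t ** W t = A &
        (W t)^t ** W t = S0] ].
Proof.
(* [Z] and [W] are the two block columns of [F]; their equations are the block columns of
   [F' = F ** B]. *)
pose F t := mrow Y0 eta ** mexp (t *: B).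
pose Z t := F t ** mcol (mid p) 0; pose W t := F t ** mcol 0 (mid p).
have FE t : F t = mrow (Z t) (W t).
  rewrite /Z /W -[LHS]mmul1r.
  have -> : mid (p + p) = mrow (mcol (mid p) 0) (mcol 0 (mid p)) :> mat _ _.
    by rewrite /mrow /mcol /mid -block_mxEh -scalar_mx_block.
  exact: mul_mx_row.
have dF t : has_deriv F t (F t ** B).
  apply: has_deriv_eq (has_deriv_mmull _ (has_deriv_mexp B t)) _.
  by rewrite mexp_comm mmulA.
have F0 : F 0 = mrow Y0 eta by rewrite /F scale0r mexp0 mmul1r.
have FF t : (F t)^t ** F t = G0.
  have GF : (F t)^t ** F t = (mexp (t *: B))^t ** G0 ** mexp (t *: B).
    rewrite /F adjM !mmulA -[in LHS](mmulA _ _ (mrow _ _)) adj_mrow mcol_row defS0 defA.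
    by rewrite (stiefel_skew etaT) defA [_ ** Y0](Y0St : Y0^t ** Y0 = mid p).
  rewrite GF.
  have dG s : has_deriv (fun s => (mexp (s *: B))^t ** G0 ** mexp (s *: B)) s 0.
    have dM := has_deriv_mexp B s.
    apply: has_deriv_eq (has_deriv_mmul (has_deriv_mmulr G0 (has_deriv_adj dM)) dM) _.
    have /eqP := stiefel_gram_invariant; rewrite addr_eq0 => /eqP GB.
    rewrite adjM -!mmulA [G0 ** (B ** _)]mmulA GB.
    by rewrite mmulNl mmulNr !mmulA addNr.
  rewrite (@has_deriv0_cst _ _ _ _ setT _ t 0 _ _ _ (fun s _ => dG s)) //.
  by rewrite scale0r mexp0 adj1 mmul1l mmul1r.
exists Z, W; split=> [t|t|t||t].
- rewrite /stiefel_exp_curve -/(F t) /Z -mmulA; congr (_ ** _).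
  have -> : t *: - (c *: A) = ((1 - 2 * alpha) * t) *: A by mat_lin.
  by rewrite /mcol /mmul mul_col_mx mul1mx mul0mx.
- apply: has_deriv_eq (has_deriv_mmulr _ (dF t)) _.
  by rewrite -mmulA mblock_col FE mrow_col; mat_expand; rewrite !addr0.
- apply: has_deriv_eq (has_deriv_mmulr _ (dF t)) _.
  by rewrite -mmulA mblock_col FE mrow_col; mat_expand; rewrite !add0r; mat_expand.
- by rewrite /Z /W F0 !mrow_col; mat_expand; rewrite addr0 add0r.
- have := FF t; rewrite FE adj_mrow mcol_row => /eq_block_mx[ZZ ZW _ WW].
  by split.
Qed.

(** The factor [exp (- c t A)] cancels the term [c Z A] of [Z'], so the velocity is
    [W ** exp (- c t A)]. As [A] is skew this factor is unitary, and the Gram relations of [Z] and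
    [W] carry over to the curve and its velocity. *)
Lemma stiefel_exp_curveP : exists W : R -> mat n p,
  let Y := stiefel_exp_curve in
  [/\ forall t, (Y t)^t ** Y t = mid p,
     forall t, has_deriv Y t (W t),
     forall t, has_deriv W t (- (Y t ** (W t)^t ** W t)
       - (2 * (1 - alpha)) *: ((mid n - Y t ** (Y t)^t) ** (W t ** (W t)^t) ** Y t)),
     Y 0 = Y0 & W 0 = eta].
Proof.
have [Z [W [YE dZ dW [Z0 W0] inv]]] := stiefel_system.
pose E t : mat p p := mexp (t *: (c *: A)).
pose Ei t : mat p p := mexp (t *: - (c *: A)).
have EEi t : E t ** Ei t = mid p by exact: mexpZNM'.
have EiE t : Ei t ** E t = mid p by exact: mexpNZM.
have AEi t : A ** Ei t = Ei t ** A by apply: mexp_intertwine; mat_expand.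
have dEi t : has_deriv Ei t (- c *: (A ** Ei t)).
  by rewrite -mmulZl scaleNr; exact: has_deriv_mexp.
have Ei_adj t : (Ei t)^t = E t.
  by rewrite /Ei mexp_adj; congr mexp; mat_expand; rewrite Askew; mat_lin.
have Ei0 : Ei 0 = mid p by rewrite /Ei scale0r mexp0.
have YE' t : stiefel_exp_curve t = Z t ** Ei t := YE t.
(* From here on the exponentials are abstract: only the recorded relations between [E] and [Ei] are
   used. *)
move: E Ei EEi EiE AEi dEi Ei_adj Ei0 YE' {YE} => E Ei EEi EiE AEi dEi Ei_adj Ei0 YE.
exists (fun t => W t ** Ei t) => Y; split.
- move=> t; have [ZZ _ _] := inv t; rewrite /Y YE adjM Ei_adj.
  by rewrite mmulA -(mmulA _ _ (Z t)) ZZ mmul1r.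
- move=> t; have -> : Y = (fun s => Z s ** Ei s) by apply/funext.
  apply: has_deriv_eq (has_deriv_mmul (dZ t) (dEi t)) _.
  mat_expand; rewrite -!mmulA; mat_lin.
- move=> t; have [ZZ ZW WW] := inv t.
  have WZ : (W t)^t ** Z t = - A by rewrite -Askew -ZW adjM adjK.
  apply: has_deriv_eq (has_deriv_mmul (dW t) (dEi t)) _.
  rewrite /Y YE !adjM Ei_adj.
  have -> : Z t ** Ei t ** (E t ** (W t)^t) ** (W t ** Ei t) = Z t ** S0 ** Ei t.
    by rewrite !mmulA -(mmulA _ (Ei t)) EiE mmul1r -(mmulA _ _ (W t)) WW.
  have -> : W t ** Ei t ** (E t ** (W t)^t) = W t ** (W t)^t.
    by rewrite !mmulA -(mmulA _ (Ei t)) EiE mmul1r.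
  have -> : Z t ** Ei t ** (E t ** (Z t)^t) = Z t ** (Z t)^t.
    by rewrite !mmulA -(mmulA _ (Ei t)) EiE mmul1r.
  rewrite mmulDl mmul1l mmulNl -!mmulA [(Z t)^t ** _]mmulA ZW.
  mat_expand; rewrite -!(mmulA _ (W t)^t (Z t)) WZ; mat_expand; mat_lin.
- by rewrite /Y YE Z0 Ei0 mmul1r.
- by rewrite W0 Ei0 mmul1r.
Qed.

(* [Y^t ** W] is constant and [E^-1 ** (W^t ** W) ** E] as well, where
   [E t = exp (c t A)]; so [[Y W] ** E] solves the linear system. *)
Lemma stiefel_exp_unique (I : set R) (Y W : R -> mat n p) : is_interval I -> I 0 ->
  (forall t, I t -> stiefel (Y t)) ->
  (forall t, I t -> stiefel_tangent (Y t) (W t)) ->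
  (forall t, I t -> has_deriv Y t (W t)) ->
  (forall t, I t -> has_deriv W t (- (Y t ** (W t)^t ** W t)
       - (2 * (1 - alpha)) *: ((mid n - Y t ** (Y t)^t) ** (W t ** (W t)^t) ** Y t))) ->
  Y 0 = Y0 -> W 0 = eta -> forall t, I t -> Y t = stiefel_exp_curve t.
Proof.
move=> Iitv I0 YSt WT dY dW Y00 W00.
(* In the derivative of [Y^t ** W], the terms with [W^t ** W] cancel, and the remaining one vanishes
   because [Y^t] annihilates [I - Y Y^t]. *)
have AYW t : I t -> (Y t)^t ** W t = A.
  move=> It; rewrite -defA -Y00 -W00.
  apply: (@has_deriv0_cst _ _ _ _ I (fun t => (Y t)^t ** W t)) => // s Is.
  apply: has_deriv_eq (has_deriv_mmul (has_deriv_adj (dY s Is)) (dW s Is)) _.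
  have YY : (Y s)^t ** Y s = mid p := YSt s Is.
  mat_expand; rewrite YY; mat_expand; mat_lin.
have WY t : I t -> (W t)^t ** Y t = - A.
  by move=> It; rewrite stiefel_skew ?AYW //; exact: WT.
pose E t : mat p p := mexp (t *: (c *: A)).
pose Ei t : mat p p := mexp (t *: - (c *: A)).
have EEi t : E t ** Ei t = mid p by exact: mexpZNM'.
have EiE t : Ei t ** E t = mid p by exact: mexpNZM.
have AE t : A ** E t = E t ** A by apply: mexp_intertwine; mat_expand.
have AEi t : A ** Ei t = Ei t ** A by apply: mexp_intertwine; mat_expand.
have dE t : has_deriv E t (c *: (A ** E t)).
  by rewrite -mmulZl; exact: has_deriv_mexp.
have dEi t : has_deriv Ei t (- c *: (A ** Ei t)).
  by rewrite -mmulZl scaleNr; exact: has_deriv_mexp.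
have E0 : E 0 = mid p by rewrite /E scale0r mexp0.
have Ei0 : Ei 0 = mid p by rewrite /Ei scale0r mexp0.
have Edef t : mexp (((1 - 2 * alpha) * t) *: A) = Ei t by congr mexp; mat_lin.
rewrite /stiefel_exp_curve; move: E Ei EEi EiE AE AEi dE dEi E0 Ei0 Edef.
move=> E Ei EEi EiE AE AEi dE dEi E0 Ei0 Edef.
have dW' t : I t -> has_deriv W t (- (Y t ** (W t)^t ** W t)
    + (2 * (1 - alpha)) *: (W t ** A - Y t ** A ** A)).
  move=> It; apply: has_deriv_eq (dW t It) _.
  rewrite -!(mmulA _ _ (Y t)) WY // mmulDl mmul1l mmulNl.
  mat_expand; rewrite -!(mmulA _ (Y t)^t (W t)) AYW //; mat_lin.
(* Equivalent to the constancy of [Ei ** (W^t ** W) ** E]: the derivatives of the outer factors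
   compensate the commutator of [A] with [W^t ** W]. *)
have SE t : I t -> (W t)^t ** W t ** E t = E t ** S0.
  move=> It; suff H : Ei t ** ((W t)^t ** W t) ** E t = S0.
    by rewrite -H !mmulA EEi mmul1l.
  rewrite -defS0 -W00.
  have -> : (W 0)^t ** W 0 = Ei 0 ** ((W 0)^t ** W 0) ** E 0.
    by rewrite Ei0 E0 mmul1l mmul1r.
  apply: (@has_deriv0_cst _ _ _ _ I (fun t => Ei t ** ((W t)^t ** W t) ** E t)) => // s Is.
  have dWs := dW' s Is.
  apply: has_deriv_eq (has_deriv_mmul (has_deriv_mmul (dEi s)
    (has_deriv_mmul (has_deriv_adj dWs) dWs)) (dE s)) _.
  rewrite AEi; mat_expand; rewrite Askew.
  rewrite -!(mmulA _ (W s)^t (Y s)) -!(mmulA _ (Y s)^t (W s)) AYW // WY //.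
  mat_expand; mat_lin.
pose F t := (Y t ** E t) ** mrow (mid p) 0 + (W t ** E t) ** mrow 0 (mid p).
have dF t : I t -> has_deriv F t (F t ** B).
  move=> It; apply: has_deriv_eq (has_derivD
    (has_deriv_mmulr _ (has_deriv_mmul (dY t It) (dE t)))
    (has_deriv_mmulr _ (has_deriv_mmul (dW' t It) (dE t)))) _.
  rewrite /F -!mrowE mrow_block; congr mrow.
    by rewrite AE; mat_expand; mat_lin.
  (* Here [SE] trades the moving Gram matrix for the constant [S0] in the last block column. *)
  have ED : E t ** D = (2 * (alpha - 1)) *: (A ** A ** E t) - (W t)^t ** W t ** E t.
    by rewrite mmulDr mmulNr -SE // mmulZr mmulA -AE -mmulA -AE mmulA.
  by rewrite -!(mmulA _ (E t)) ED -AE; mat_expand; mat_lin.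
have FE t : F t ** mcol (mid p) 0 = Y t ** E t.
  by rewrite /F -mrowE mrow_col mmul1r mmul0r addr0.
move=> t It; rewrite Edef.
have -> : Y t = F t ** mcol (mid p) 0 ** Ei t by rewrite FE -mmulA EEi mmul1r.
have F0 : F 0 = mrow Y0 eta by rewrite /F E0 !mmul1r Y00 W00 -mrowE.
have EiC : mcol (mid p) 0 ** Ei t = mcol (Ei t) (0 : mat p p).
  by rewrite /mcol /mmul mul_col_mx mul1mx mul0mx.
by rewrite (linear_ode_unique Iitv I0 dF It) F0 -mmulA EiC.
Qed.

End StiefelSystem.

(** * Smooth maps *)

Section SmoothMaps.
Variables (R : realType) (K : scalars) (V : normedModType R) (D : set V).
Hypothesis oD : open D.
Local Notation mat := (mat R K).

Lemma smooth_cst (W : normedModType R) (w : W) : smooth_on D (fun=> w).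
Proof. by move=> k; exact: Ck_on_cst. Qed.

Lemma smooth_id : smooth_on D id.
Proof. by move=> k; exact: Ck_on_id. Qed.

Lemma smoothD (W : normedModType R) (f g : V -> W) : smooth_on D f -> smooth_on D g ->
  smooth_on D (fun x => f x + g x).
Proof. by move=> sf sg k; exact: Ck_onD. Qed.

Lemma smooth_bl (W X : normedModType R) (L : W -> X) (f : V -> W) :
  bounded_linear L -> smooth_on D f -> smooth_on D (fun x => L (f x)).
Proof. by move=> bL sf k; exact: (Ck_on_bl oD bL (sf k)). Qed.

Lemma smooth_bil (W X Y : normedModType R) (B : W -> X -> Y) (f : V -> W) (g : V -> X) :
  bounded_bilinear B -> smooth_on D f -> smooth_on D g ->
  smooth_on D (fun x => B (f x) (g x)).
Proof. by move=> bB sf sg k; exact: (Ck_on_bil oD bB (sf k) (sg k)). Qed.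

Lemma smooth_sum (I : Type) (r : seq I) (W : normedModType R) (f : I -> V -> W) :
  (forall i, smooth_on D (f i)) -> smooth_on D (fun x => \sum_(i <- r) f i x).
Proof. by move=> sf k; apply: Ck_on_sum => // i; exact: sf. Qed.

Lemma smoothZ (W : normedModType R) (f : V -> W) a : smooth_on D f ->
  smooth_on D (fun x => a *: f x).
Proof. exact: (smooth_bl (scale_bounded_linear W a)). Qed.

Lemma smooth_scale (W : normedModType R) (f : V -> R^o) (g : V -> W) :
  smooth_on D f -> smooth_on D g -> smooth_on D (fun x => (f x : R) *: g x).
Proof. exact: (smooth_bil (scale_bounded_bilinear W)). Qed.

Lemma smoothN (W : normedModType R) (f : V -> W) : smooth_on D f ->
  smooth_on D (fun x => - f x).
Proof.
move=> sf; have -> : (fun x => - f x) = (fun x => (-1) *: f x).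
  by apply/funext => x; rewrite scaleN1r.
exact: smoothZ.
Qed.

Lemma smooth_mmul m n p (f : V -> mat m n) (g : V -> mat n p) :
  smooth_on D f -> smooth_on D g -> smooth_on D (fun x => f x ** g x).
Proof. exact: (smooth_bil (mmul_bounded_bilinear R K m n p)). Qed.

Lemma smooth_adj m n (f : V -> mat m n) :
  smooth_on D f -> smooth_on D (fun x => (f x)^t).
Proof. exact: (smooth_bl (adj_bounded_linear R K m n)). Qed.

Lemma smooth_trR n (f : V -> mat n n) :
  smooth_on D f -> smooth_on D (fun x => trR (f x) : R^o).
Proof. exact: (smooth_bl (trR_bounded_linear R K n)). Qed.

Lemma smooth_coord m n i (f : V -> mat m n) :
  smooth_on D f -> smooth_on D (fun x => mat_coord i (f x) : R^o).
Proof. exact: (smooth_bl (coord_bounded_linear R K i)). Qed.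

Lemma smooth_differentiable (W : normedModType R) (f : V -> W) x :
  smooth_on D f -> D x -> differentiable f x.
Proof. by move=> /(_ 1%N)[df _]; exact: df. Qed.

Lemma smooth_ext (W : normedModType R) (f g : V -> W) :
  (forall x, D x -> f x = g x) -> smooth_on D f -> smooth_on D g.
Proof. by move=> fg sf k; exact: Ck_on_ext (sf k). Qed.

Lemma smooth_diff (W : normedModType R) (f : V -> W) v :
  smooth_on D f -> smooth_on D (fun x => 'd f x v).
Proof. by move=> sf k; have [_] := sf k.+1; exact. Qed.

End SmoothMaps.

(** [smooth_diff] treats a fixed direction; a variable one is expanded on the real basis, with
    smooth coefficients. *)
Lemma smooth_diff_field (R : realType) (K : scalars) m n (W : normedModType R)
    (U : mat R K m n -> W) (X : mat R K m n -> mat R K m n) (D : set (mat R K m n)) :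
  open D -> smooth_on D U -> smooth_on D X -> smooth_on D (fun x => 'd U x (X x)).
Proof.
move=> oD sU sX.
have -> : (fun x => 'd U x (X x)) =
    (fun x => \sum_i mat_coord i (X x) *: 'd U x (mat_basis R K i)).
  apply/funext => x; rewrite {1}(mat_decomp (X x)) linear_sum; apply: eq_bigr => i _.
  by rewrite linearZ.
apply: smooth_sum => // i; apply: smooth_scale => //; last exact: smooth_diff.
exact: smooth_coord.
Qed.

Lemma smooth_derive1 (R : realType) (V : normedModType R) (I : set R) (f : R -> V) :
  open I -> smooth_on (I : set R^o) (f : R^o -> V) ->
  smooth_on (I : set R^o) (derive1 f : R^o -> V).
Proof.
move=> oI sf; have oI' : open (I : set R^o) by [].
apply: (smooth_ext oI' _ (smooth_diff (1 : R^o) sf)) => t It.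
by rewrite derive1E' //; exact: smooth_differentiable sf It.
Qed.

Lemma smooth_has_deriv (R : realType) (V : normedModType R) (I : set R) (f : R -> V) t :
  smooth_on (I : set R^o) (f : R^o -> V) -> I t -> has_deriv f t (derive1 f t).
Proof. by move=> sf It; apply: has_derivP; exact: smooth_differentiable sf It. Qed.

(** * The Levi-Civita connection *)

Section StiefelGeometry.
Variables (R : realType) (K : scalars) (n p : nat).
Local Notation E := (mat R K n p).
Local Notation St := (@stiefel R K n p).
Local Notation T := (@stiefel_tangent R K n p).

(** The first formula is taken with [alpha = 0], an arbitrary choice: only the initial data and the
    membership in the manifold matter here. *)
Lemma stiefel_curve_through (Y u : E) : St Y -> T Y u ->
  exists2 c : R -> E, c 0 = Y & has_deriv c 0 u /\ forall t, St (c t).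
Proof.
move=> SY Tu.
have [W [cSt dc _ c0 W0]] := stiefel_exp_curveP 0 SY Tu erefl erefl.
exists (stiefel_exp_curve 0 Y u (Y^t ** u) (u^t ** u)); first exact: c0.
by split; [exact: has_deriv_eq (dc 0) W0 | exact: cSt].
Qed.

Lemma diff_stiefel_cst (W : normedModType R) (f : E -> W) (w : W) (Y u : E) :
  St Y -> T Y u -> differentiable f Y -> (forall Z, St Z -> f Z = w) -> 'd f Y u = 0.
Proof.
move=> SY Tu df fw; have [c c0 [dc cSt]] := stiefel_curve_through SY Tu.
rewrite -c0 in df *; apply: has_deriv_unique (has_deriv_diff df dc) _.
have -> : f \o c = fun=> w by apply/funext => t; exact: fw.
exact: has_deriv_cst.
Qed.

(** Orthogonal projection onto the tangent space for the Euclidean inner product. Being polynomial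
    in [Y] and [Y^t], it extends smoothly to all matrices and makes a global tangent field out of
    each fixed [w]. *)
Definition stiefel_proj (Y w : E) : E := w - 2^-1 *: (Y ** (Y^t ** w + w^t ** Y)).

Lemma stiefel_projT (Y w : E) : St Y -> T Y (stiefel_proj Y w).
Proof.
move=> SY; have YY : Y^t ** Y = mid p := SY.
rewrite /stiefel_tangent /stiefel_proj /=; mat_expand; rewrite YY; mat_expand.
rewrite -!(mmulA _ Y^t Y) YY; mat_expand; mat_lin.
Qed.

Lemma stiefel_proj_id (Y w : E) : T Y w -> stiefel_proj Y w = w.
Proof. by move=> Tw; rewrite /stiefel_proj (Tw : _ + _ = 0) mmul0r scaler0 subr0. Qed.

Lemma stiefel_proj_field (w : E) : vector_field St T (stiefel_proj ^~ w).
Proof.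
split; last by move=> Y SY; exact: stiefel_projT.
have oT : open [set: E] by exact: openT.
have sid : smooth_on [set: E] (id : E -> E) by exact: smooth_id.
apply: smoothD => //; first exact: smooth_cst.
apply: smoothN => //; apply: smoothZ => //; apply: smooth_mmul => //; apply: smoothD => //.
  by apply: smooth_mmul => //; [exact: smooth_adj | exact: smooth_cst].
by apply: smooth_mmul => //; exact: smooth_cst.
Qed.

Variables (alpha0 alpha1 : R).
Hypothesis (a0 : 0 < alpha0) (a1 : 0 < alpha1).
Variable alpha : R.
Hypothesis alphaE : alpha1 = alpha * alpha0.
Local Notation g := (@stiefel_inner R K n p alpha0 alpha1).

(* polarization of the quadratic term of the geodesic equation *)
Definition stiefel_christoffel (Y u v : E) : E :=
  2^-1 *: (Y ** (u^t ** v + v^t ** u)) +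
  (1 - alpha) *: ((mid n - Y ** Y^t) ** (u ** v^t + v ** u^t) ** Y).

Local Notation Gam := stiefel_christoffel.

Definition stiefel_nabla (Y u : E) (U : E -> E) : E := 'd U Y u + Gam Y u (U Y).

Lemma christoffel_sym (Y u v : E) : Gam Y u v = Gam Y v u.
Proof. by rewrite /Gam (addrC (u^t ** v)) (addrC (u ** v^t)). Qed.

Lemma christoffel_linear (Y u : E) : linear (Gam Y u).
Proof. by move=> a v w; rewrite /Gam; mat_expand; mat_lin. Qed.

Lemma smooth_christoffel (V : normedModType R) (D : set V) (Y u v : V -> E) :
  open D -> smooth_on D Y -> smooth_on D u -> smooth_on D v ->
  smooth_on D (fun x => Gam (Y x) (u x) (v x)).
Proof.
move=> oD sY su sv.
apply: smoothD => //; apply: smoothZ => //.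
  apply: smooth_mmul => //; apply: smoothD => //; apply: smooth_mmul => //;
    exact: smooth_adj.
apply: smooth_mmul => //; apply: smooth_mmul => //.
  apply: smoothD => //; first exact: smooth_cst.
  by apply: smoothN => //; apply: smooth_mmul => //; exact: smooth_adj.
by apply: smoothD => //; apply: smooth_mmul => //; exact: smooth_adj.
Qed.

Lemma stiefel_innerC (Y u v : E) : g Y u v = g Y v u.
Proof.
rewrite /stiefel_inner /stiefel_gop -[LHS]trR_adj; congr trR; mat_expand; mat_lin.
Qed.

Lemma stiefel_innerD (Y u v w : E) : g Y (u + v) w = g Y u w + g Y v w.
Proof. by rewrite /stiefel_inner adjD mmulDl trRD. Qed.

Lemma stiefel_innerDr (Y u v w : E) : g Y w (u + v) = g Y w u + g Y w v.
Proof. by rewrite stiefel_innerC stiefel_innerD !(stiefel_innerC _ w). Qed.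

Lemma stiefel_innerB (Y u v w : E) : g Y (u - v) w = g Y u w - g Y v w.
Proof. by rewrite /stiefel_inner adjD adjN mmulDl mmulNl trRD trRN. Qed.

Lemma stiefel_inner_nondeg (Y w : E) : St Y -> T Y w ->
  (forall v, T Y v -> g Y w v = 0) -> w = 0.
Proof.
move=> SY Tw gw0; have YY : Y^t ** Y = mid p := SY.
have wY := stiefel_skew Tw.
(* [v] is the inverse of the metric operator applied to [w]; it is tangent, and pairing it with [w]
   gives the trace of [w^t ** w]. *)
pose v : E := alpha0^-1 *: w + (alpha1^-1 - alpha0^-1) *: (Y ** Y^t ** w).
have Tv : T Y v.
  rewrite /stiefel_tangent /v /=; move: alpha0^-1 alpha1^-1 => x y.
  mat_expand; rewrite YY; mat_expand.
  by rewrite -!(mmulA _ Y^t Y) YY; mat_expand; rewrite wY; mat_lin.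
have [a0n a1n] : alpha0 != 0 /\ alpha1 != 0 by rewrite !gt_eqF.
apply: trR_sqr_eq0; rewrite -[RHS](gw0 v Tv) /stiefel_inner /stiefel_gop /v.
congr trR; mat_expand; rewrite -!(mmulA _ Y^t Y) YY; mat_expand.
apply: mat_coordP => i; rewrite ?(mat_coordD, mat_coordN, mat_coordZ).
by field; rewrite a0n a1n.
Qed.
(** The first summand of [Gam] is [Y] times a Hermitian matrix; it is orthogonal to the tangent
    space because [Y^t ** w] is skew. The weight of the second summand becomes
    [(1 - alpha) alpha0 = alpha0 - alpha1]. *)
Lemma inner_christoffel (Y u v w : E) : St Y -> T Y u -> T Y v -> T Y w ->
  g Y (Gam Y u v) w = - (alpha1 - alpha0) *
    (trR (Y^t ** v ** u^t ** w) + trR (Y^t ** u ** v^t ** w)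
     + trR ((Y^t ** v) ** (Y^t ** u) ** (Y^t ** w))
     + trR ((Y^t ** u) ** (Y^t ** v) ** (Y^t ** w))).
Proof.
move=> SY Tu Tv Tw; have YY : Y^t ** Y = mid p := SY.
have uY := stiefel_skew Tu; have vY := stiefel_skew Tv; have wY := stiefel_skew Tw.
have H : trR (v^t ** u ** (Y^t ** w)) = - trR (u^t ** v ** (Y^t ** w)).
  by rewrite -[LHS]trR_adj !adjM !adjK wY mmulNl trRN trRC.
have gw : (Gam Y u v)^t ** stiefel_gop alpha0 alpha1 Y w =
    (2^-1 * alpha1) *: ((u^t ** v + v^t ** u) ** (Y^t ** w)) +
    ((1 - alpha) * alpha0) *:
      (Y^t ** (u ** v^t + v ** u^t) ** (w - Y ** (Y^t ** w))).
  rewrite /Gam /stiefel_gop; mat_expand; rewrite -!(mmulA _ Y^t Y) YY; mat_expand.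
  mat_lin.
rewrite /stiefel_inner gw mulrBl mul1r -alphaE.
rewrite trRD !trRZ mmulDl trRD H addrC subrr mulr0 addr0.
have -> : Y^t ** (u ** v^t + v ** u^t) ** (w - Y ** (Y^t ** w)) =
    Y^t ** v ** u^t ** w + Y^t ** u ** v^t ** w
    + Y^t ** v ** (Y^t ** u) ** (Y^t ** w) + Y^t ** u ** (Y^t ** v) ** (Y^t ** w).
  mat_expand; rewrite -!(mmulA _ u^t Y) -!(mmulA _ v^t Y) uY vY; mat_expand; mat_lin.
by rewrite !trRD opprB.
Qed.

(** The left side is the derivative of the metric along a curve of velocity [u], the right side its
    value predicted by [inner_christoffel]. Transposing a product of three skew matrices reverses
    the order and the sign, so the cubic traces cancel. *)
Lemma metric_derivative_algebra (Y u v w dv dw : E) : T Y u -> T Y v -> T Y w ->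
  trR (v^t ** (alpha0 *: dw + (alpha1 - alpha0) *:
        (Y ** Y^t ** dw + (Y ** u^t + u ** Y^t) ** w)) +
       dv^t ** (alpha0 *: w + (alpha1 - alpha0) *: (Y ** Y^t ** w))) =
  g Y dv w + - (alpha1 - alpha0) *
    (trR (Y^t ** v ** u^t ** w) + trR (Y^t ** u ** v^t ** w) +
     trR (Y^t ** v ** (Y^t ** u) ** (Y^t ** w)) +
     trR (Y^t ** u ** (Y^t ** v) ** (Y^t ** w))) +
  (g Y v dw + - (alpha1 - alpha0) *
    (trR (Y^t ** w ** u^t ** v) + trR (Y^t ** u ** w^t ** v) +
     trR (Y^t ** w ** (Y^t ** u) ** (Y^t ** v)) +
     trR (Y^t ** u ** (Y^t ** w) ** (Y^t ** v)))).
Proof.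
move=> Tu Tv Tw.
have uY := stiefel_skew Tu; have vY := stiefel_skew Tv; have wY := stiefel_skew Tw.
have -> : v^t ** (alpha0 *: dw + (alpha1 - alpha0) *:
        (Y ** Y^t ** dw + (Y ** u^t + u ** Y^t) ** w)) =
    v^t ** stiefel_gop alpha0 alpha1 Y dw + (alpha1 - alpha0) *:
      (v^t ** Y ** (u^t ** w) + v^t ** u ** (Y^t ** w)).
  by rewrite /stiefel_gop; mat_expand; mat_lin.
rewrite 2!trRD -/(g Y v dw) -/(g Y dv w) trRZ trRD vY mmulNl trRN mmulA.
have h1 : trR (Y^t ** w ** u^t ** v) = - trR (v^t ** u ** (Y^t ** w)).
  by rewrite -[LHS]trR_adj -(mmulA _ u^t v) !adjM !adjK wY mmulNr trRN.
have h2 : trR (Y^t ** u ** w^t ** v) = - trR (Y^t ** u ** v^t ** w).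
  rewrite -[LHS]trR_adj -(mmulA _ w^t v) !adjM !adjK uY mmulNr trRN trRC.
  by rewrite (mmulA _ v^t).
have h3 (a b d : mat R K p p) : trR (b ** a ** d) = trR (a ** d ** b).
  by rewrite -mmulA trRC.
have h4 : trR (Y^t ** u ** (Y^t ** w) ** (Y^t ** v)) =
    - trR (Y^t ** u ** (Y^t ** v) ** (Y^t ** w)).
  rewrite -[LHS]trR_adj !adjM !adjK uY vY wY !mmulNl !mmulNr opprK trRN.
  by rewrite mmulA -h3.
rewrite h1 h2 (h3 (Y^t ** u) (Y^t ** v)) (h3 (Y^t ** u) (Y^t ** w)) h4.
move: (trR _) (trR _) (trR _) (trR _) (g Y dv w) (g Y v dw) => t1 t2 t3 t4 t5 t6.
ring.
Qed.

Let oT : open [set: E]. Proof. exact: openT. Qed.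

Lemma field_differentiable (U : E -> E) Y : vector_field St T U -> differentiable U Y.
Proof. by move=> [sU _]; exact: smooth_differentiable sU _. Qed.

Lemma field_has_deriv (U : E -> E) (c : R -> E) t v : vector_field St T U ->
  has_deriv c t v -> has_deriv (U \o c) t ('d U (c t) v).
Proof. by move=> fU; apply: has_deriv_diff; exact: field_differentiable. Qed.

(** Comes from differentiating the tangency relation of [U] along a curve of the manifold with
    velocity [u]. *)
Lemma field_tangent_deriv (U : E -> E) Y u : vector_field St T U -> St Y -> T Y u ->
  Y^t ** 'd U Y u + ('d U Y u)^t ** Y = - (u^t ** U Y + (U Y)^t ** u).
Proof.
move=> fU SY Tu; have [c c0 [dc cSt]] := stiefel_curve_through SY Tu.
have dU := field_has_deriv fU dc.
have := has_derivD (has_deriv_mmul (has_deriv_adj dc) dU)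
  (has_deriv_mmul (has_deriv_adj dU) dc).
rewrite /= c0 => /has_deriv_unique H; apply/eqP; rewrite -addr_eq0; apply/eqP.
transitivity (Y^t ** 'd U Y u + u^t ** U Y + ((U Y)^t ** u + ('d U Y u)^t ** Y)).
  by rewrite addrACA (addrC (('d U Y u)^t ** Y)).
apply: H; apply: has_deriv_near (has_deriv_cst 0 0); near=> s.
by have := fU.2 _ (cSt s).
Unshelve. all: by end_near. Qed.

(** The first summand of [Gam] compensates the right side of the hypothesis, and [Y^t] annihilates
    the second. With [w] free, this serves fields on the manifold as well as fields along a
    curve. *)
Lemma christoffel_tangent (Y u v w : E) : St Y ->
  Y^t ** w + w^t ** Y = - (u^t ** v + v^t ** u) -> T Y (w + Gam Y u v).
Proof.
move=> SY wE; have YY : Y^t ** Y = mid p := SY.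
rewrite /stiefel_tangent /= adjD mmulDl mmulDr addrACA wE.
rewrite /Gam; mat_expand; rewrite YY; mat_expand; rewrite -!(mmulA _ Y^t Y) YY.
mat_expand; mat_lin.
Qed.

Lemma nabla_tangent Y u U : St Y -> T Y u -> vector_field St T U ->
  T Y (stiefel_nabla Y u U).
Proof.
by move=> SY Tu fU; apply: christoffel_tangent => //; exact: field_tangent_deriv.
Qed.

Lemma nabla_metric Y u U V : St Y -> T Y u -> vector_field St T U -> vector_field St T V ->
  'd (fun Z => g Z (U Z) (V Z) : R^o) Y u =
    g Y (stiefel_nabla Y u U) (V Y) + g Y (U Y) (stiefel_nabla Y u V).
Proof.
move=> SY Tu fU fV; have [c c0 [dc cSt]] := stiefel_curve_through SY Tu.
have TU : T Y (U Y) := fU.2 Y SY; have TV : T Y (V Y) := fV.2 Y SY.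
have sg : smooth_on [set: E] (fun Z => g Z (U Z) (V Z) : R^o).
  have [sU _] := fU; have [sV _] := fV.
  have sid : smooth_on [set: E] (id : E -> E) by exact: smooth_id.
  apply: smooth_trR => //; apply: smooth_mmul => //; first exact: smooth_adj.
  apply: smoothD => //; apply: smoothZ => //; apply: smooth_mmul => //.
  by apply: smooth_mmul => //; exact: smooth_adj.
have dU := field_has_deriv fU dc; have dV := field_has_deriv fV dc.
have := has_deriv_diff (smooth_differentiable sg (I : [set: E] (c 0))) dc.
have dg := has_deriv_bl (trR_bounded_linear R K p) (has_deriv_mmul (has_deriv_adj dU)
  (has_derivD (has_derivZ alpha0 dV) (has_derivZ (alpha1 - alpha0)
    (has_deriv_mmul (has_deriv_mmul dc (has_deriv_adj dc)) dV)))).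
move=> /has_deriv_unique /(_ dg); rewrite /= c0 => ->.
rewrite /stiefel_nabla stiefel_innerD stiefel_innerDr (stiefel_innerC _ _ (Gam _ _ _)).
rewrite !inner_christoffel //.
exact: metric_derivative_algebra.
Qed.

End StiefelGeometry.

Ltac inner_lra := repeat match goal with
  |- context [@stiefel_inner ?R ?K ?n ?p ?a ?b ?Y ?u ?v] =>
    generalize (@stiefel_inner R K n p a b Y u v); intro end;
  intros; lra.

(** * Existence and uniqueness of the Levi-Civita connection *)

Section StiefelConnection.
Variables (R : realType) (K : scalars) (n p : nat).
Local Notation E := (mat R K n p).
Local Notation St := (@stiefel R K n p).
Local Notation T := (@stiefel_tangent R K n p).
Variables (alpha0 alpha1 : R).
Hypothesis (a0 : 0 < alpha0) (a1 : 0 < alpha1).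
Variable alpha : R.
Hypothesis alphaE : alpha1 = alpha * alpha0.
Local Notation g := (@stiefel_inner R K n p alpha0 alpha1).
Local Notation Gam := (@stiefel_christoffel R K n p alpha).
Local Notation nab := (@stiefel_nabla R K n p alpha).

Lemma stiefel_nabla_connection : is_connection St T nab.
Proof.
have arr (a : R) (x y z w : E) : a *: x + y + (a *: z + w) = a *: (x + z) + (y + w).
  by rewrite scalerDr addrACA.
split.
- exact: nabla_tangent.
- move=> Y u U V SY Tu fU fV UV.
  have dU := differentiableP (field_differentiable Y fU).
  have dV := differentiableP (field_differentiable Y fV).
  have dUV := is_diffB dU dV.
  (* Independence of the extension: [U - V] vanishes on the manifold, so its differential vanishes
     on tangent vectors. *)
  have H0 : 'd (U - V) Y u = 0.
    apply: (diff_stiefel_cst SY Tu (@ex_diff _ _ _ _ _ _ _ dUV)) => Z SZ.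
    by rewrite !fctE UV // subrr.
  have E1 : 'd U Y u = 'd V Y u.
    apply/eqP; rewrite -subr_eq0; apply/eqP; rewrite -[RHS]H0; apply/esym.
    exact: (congr1 (fun h : E -> E => h u) (@diff_val _ _ _ _ _ _ _ dUV)).
  exact: (congr2 (fun x y : E => x + Gam Y u y) E1 (UV Y SY)).
- move=> X U fX fU; exists (fun Y => nab Y (X Y) U) => //.
  have [sX TX] := fX; have [sU _] := fU.
  split; last by move=> Y SY; exact: nabla_tangent (TX Y SY) fU.
  have oT : open [set: E] by exact: openT.
  have sid : smooth_on [set: E] (id : E -> E) by exact: smooth_id.
  exact: (smoothD oT (smooth_diff_field oT sU sX)
    (smooth_christoffel alpha oT sid sX sU)).
- move=> a Y u v U SY Tu Tv fU.
  have E1 : 'd U Y (a *: u + v) = a *: 'd U Y u + 'd U Y v by exact: linearP.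
  have E2 : Gam Y (a *: u + v) (U Y) = a *: Gam Y u (U Y) + Gam Y v (U Y).
    by rewrite !(christoffel_sym alpha Y _ (U Y)); exact: christoffel_linear.
  exact: etrans (congr2 (fun x y : E => x + y) E1 E2) (arr _ _ _ _ _).
- move=> a Y u U V SY Tu fU fV.
  have dU := differentiableP (field_differentiable Y fU).
  have dV := differentiableP (field_differentiable Y fV).
  have E1 := congr1 (fun h : E -> E => h u)
    (@diff_val _ _ _ _ _ _ _ (is_diffD (is_diff_bl (scale_bounded_linear E a) dU) dV)).
  have E2 := christoffel_linear alpha Y u a (U Y) (V Y).
  exact: etrans (congr2 (fun x y : E => x + y) E1 E2) (arr _ _ _ _ _).
- move=> Y u f U SY Tu sf fU.
  have dU := differentiableP (field_differentiable Y fU).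
  have df := differentiableP (smooth_differentiable sf (I : [set: E] Y)).
  have E1 := congr1 (fun h : E -> E => h u)
    (@diff_val _ _ _ _ _ _ _ (is_diff_bil (scale_bounded_bilinear E) df dU)).
  have E2 := linear_funZ (christoffel_linear alpha Y u) (f Y) (U Y).
  apply: etrans (congr2 (fun x y : E => x + y) E1 E2) _.
  have arr' (b : R) (x y z : E) : b *: x + y + b *: z = y + b *: (x + z).
    by rewrite scalerDr addrA (addrC y).
  exact: arr'.
Qed.

Lemma stiefel_nabla_levi_civita : levi_civita St T g nab.
Proof.
split; first exact: stiefel_nabla_connection.
  move=> Y U V SY fU fV; rewrite /nab (christoffel_sym alpha Y (V Y)).
  by rewrite opprD addrACA subrr addr0.
by move=> Y u U V; exact: nabla_metric.
Qed.

(* For the difference [D] of two connections, [g (D X U) V] is symmetric in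
   [X, U] and skew in [U, V], hence zero. *)
Lemma levi_civita_unique nabla Y u U : levi_civita St T g nabla ->
  St Y -> T Y u -> vector_field St T U -> nabla Y u U = nab Y u U.
Proof.
move=> [con tor met] SY Tu fU.
have [con0 tor0 met0] := stiefel_nabla_levi_civita.
(* Torsion and symmetry concern fields, so the vectors [u], and [v] below, are extended by
   projection. *)
have [X fX XY] : exists2 X, vector_field St T X & X Y = u.
  exists (fun Z => stiefel_proj Z u); first exact: stiefel_proj_field.
  exact: stiefel_proj_id.
have swap4 (x y z w : E) : x - y = z - w -> x - z = y - w.
  move=> xyzw; have -> : x = z - w + y by rewrite -xyzw subrK.
  by rewrite addrAC [z - w]addrC addrK addrC.
pose D X U := nabla Y (X Y) U - nab Y (X Y) U.
have Dsym X' U' : vector_field St T X' -> vector_field St T U' -> D X' U' = D U' X'.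
  move=> fX' fU'; apply: swap4.
  exact: etrans (tor Y X' U' SY fX' fU') (esym (tor0 Y X' U' SY fX' fU')).
have Dskew X' U' V' : vector_field St T X' -> vector_field St T U' ->
    vector_field St T V' -> g Y (D X' U') (V' Y) = - g Y (D X' V') (U' Y).
  move=> fX' fU' fV'; have TX := fX'.2 Y SY.
  have H := etrans (esym (met Y (X' Y) U' V' SY TX fU' fV')) (met0 Y (X' Y) U' V' SY TX fU' fV').
  move: H; rewrite /D; move: (nabla _ _ U') (nabla _ _ V') (nab _ _ U') (nab _ _ V').
  move=> x y z w; rewrite !(stiefel_innerC _ _ _ (U' Y)).
  by rewrite !stiefel_innerB; inner_lra.
rewrite -XY; apply/eqP; rewrite -subr_eq0 -/(D X U); apply/eqP.
apply: (stiefel_inner_nondeg a0 a1 SY).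
  have TB (v w : E) : T Y v -> T Y w -> T Y (v - w).
    rewrite /stiefel_tangent /= => Tv Tw; rewrite adjD adjN mmulDl mmulDr mmulNl mmulNr.
    by rewrite addrACA Tv -opprD Tw oppr0 addr0.
  have T1 := conn_tangent con SY (fX.2 Y SY) fU.
  have T2 := conn_tangent con0 SY (fX.2 Y SY) fU.
  exact: (TB _ _ T1 T2).
move=> v Tv; pose V := fun Z => stiefel_proj Z v.
have fV : vector_field St T V by exact: stiefel_proj_field.
have -> : v = V Y by rewrite /V stiefel_proj_id.
(* With [a = g (D X U) V], [b = g (D X V) U] and [d = g (D V U) X], the symmetry of [D] turns the
   three relations into [a = - b], [b = - d], [d = - a], so [a = 0]. *)
have H1 := Dskew X U V fX fU fV.
have H2 := Dskew V X U fV fX fU.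
have H3 := Dskew U V X fU fV fX.
rewrite (Dsym V X) // in H2; rewrite (Dsym U V) // (Dsym U X) // in H3.
by move: H1 H2 H3; inner_lra.
Qed.

End StiefelConnection.

(** * Geodesics *)

Section StiefelGeodesics.
Variables (R : realType) (K : scalars) (n p : nat).
Local Notation E := (mat R K n p).
Local Notation St := (@stiefel R K n p).
Local Notation T := (@stiefel_tangent R K n p).
Variables (alpha0 alpha1 : R).
Hypothesis (a0 : 0 < alpha0) (a1 : 0 < alpha1).
Variable alpha : R.
Hypothesis alphaE : alpha1 = alpha * alpha0.
Local Notation g := (@stiefel_inner R K n p alpha0 alpha1).
Local Notation Gam := (@stiefel_christoffel R K n p alpha).
Local Notation nab := (@stiefel_nabla R K n p alpha).
Variables (I : set R) (c : R -> E).
Hypothesis oI : open I.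
Hypothesis cSt : curve_in St I c.
Local Notation dc := (derive1 c).

Let oI' : open (I : set R^o). Proof. exact: oI. Qed.

Lemma near_open t : I t -> \forall s \near t, I s.
Proof. by move=> It; apply: open_nbhs_nbhs. Qed.

Lemma curve_has_deriv t : I t -> has_deriv c t (dc t).
Proof. exact: smooth_has_deriv cSt.1. Qed.

Lemma field_along_has_deriv V t : field_along T I c V -> I t ->
  has_deriv V t (derive1 V t).
Proof. by move=> [sV _]; exact: smooth_has_deriv. Qed.

Lemma curve_velocity : field_along T I c dc.
Proof.
split; first exact: smooth_derive1 oI cSt.1.
move=> t It; have d := curve_has_deriv It.
have := has_deriv_mmul (has_deriv_adj d) d => /has_deriv_unique; apply.
apply: has_deriv_near (has_deriv_cst (mid p) t).
near=> s; have Is : I s by near: s; exact: near_open.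
exact/esym/(cSt.2 _ Is).
Unshelve. all: by end_near. Qed.

Definition stiefel_Dt (V : R -> E) (t : R) : E := derive1 V t + Gam (c t) (dc t) (V t).

Lemma stiefel_Dt_field V : field_along T I c V -> field_along T I c (stiefel_Dt V).
Proof.
move=> [sV TV]; split.
  have sdc := curve_velocity.1.
  exact: (smoothD oI' (smooth_derive1 oI sV) (smooth_christoffel alpha oI' cSt.1 sdc sV)).
move=> t It; apply: christoffel_tangent; first exact: cSt.2.
have d := curve_has_deriv It; have dV := field_along_has_deriv (conj sV TV) It.
have := has_derivD (has_deriv_mmul (has_deriv_adj d) dV)
  (has_deriv_mmul (has_deriv_adj dV) d).
move=> /has_deriv_unique H; apply/eqP; rewrite -addr_eq0 addrACA.
rewrite (addrC ((derive1 V t)^t ** c t)); apply/eqP; apply: H.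
apply: has_deriv_near (has_deriv_cst 0 t).
near=> s; have Is : I s by near: s; exact: near_open.
exact/esym/(TV _ Is).
Unshelve. all: by end_near. Qed.

Lemma stiefel_Dt_covariant : covariant_derivative_along St T nab I c stiefel_Dt.
Proof.
have arr (a : R) (x y z w : E) : a *: x + y + (a *: z + w) = a *: (x + z) + (y + w).
  by rewrite scalerDr addrACA.
split.
- exact: stiefel_Dt_field.
- move=> V W fV fW VW t It.
  have dV := field_along_has_deriv fV It.
  have dW : has_deriv W t (derive1 V t).
    apply: has_deriv_near dV.
    by near=> s; apply: VW; near: s; exact: near_open.
  by rewrite /stiefel_Dt (has_deriv_derive1 dW) VW.
- move=> a V W fV fW t It.
  have dV := field_along_has_deriv fV It; have dW := field_along_has_deriv fW It.
  have E1 := has_deriv_derive1 (has_derivD (has_derivZ a dV) dW).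
  have E2 := christoffel_linear alpha (c t) (dc t) a (V t) (W t).
  exact: etrans (congr2 (fun x y : E => x + y) E1 E2) (arr _ _ _ _ _).
- move=> f V sf fV t It; have dV := field_along_has_deriv fV It.
  have df := smooth_has_deriv sf It.
  have E1 := has_deriv_derive1 (has_deriv_bil (scale_bounded_bilinear E) df dV).
  have E2 := linear_funZ (christoffel_linear alpha (c t) (dc t)) (f t) (V t).
  have arr' (b : R) (x y z : E) : b *: x + y + b *: z = y + b *: (x + z).
    by rewrite scalerDr addrA (addrC y).
  exact: etrans (congr2 (fun x y : E => x + y) E1 E2) (arr' _ _ _ _).
- move=> U fU t It.
  have dU := field_has_deriv fU (curve_has_deriv It).
  exact: (congr1 (fun x : E => x + Gam (c t) (dc t) (U (c t))) (has_deriv_derive1 dU)).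
Unshelve. all: by end_near. Qed.

(** These global fields span every tangent space, since the projection fixes tangent vectors. *)
Local Notation P i := (fun Z : E => stiefel_proj Z (mat_basis R K i)).

Lemma proj_along i : field_along T I c (P i \o c).
Proof.
split; last by move=> t It; apply: stiefel_projT; exact: cSt.2.
have sw := @smooth_cst R R^o I oI' E (mat_basis R K i).
have sc := cSt.1; have sc' := smooth_adj oI' sc; have sw' := smooth_adj oI' sw.
exact: (smoothD oI' sw (smoothN oI' (smoothZ oI' 2^-1 (smooth_mmul oI' sc
  (smoothD oI' (smooth_mmul oI' sc' sw) (smooth_mmul oI' sw' sc)))))).
Qed.

(* [V] is a combination of the fields [P i \o c] with coefficients defined on
   all of [I], so that no localization is needed. *)
Lemma covariant_expansion nabla Dt V t :
  covariant_derivative_along St T nabla I c Dt -> field_along T I c V -> I t ->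
  Dt V t = \sum_i (derive1 (fun s => mat_coord i (V s) : R^o) t *: P i (c t) +
    mat_coord i (V t) *: nabla (c t) (dc t) (P i)).
Proof.
move=> cov fV It.
have scoord i : smooth_on (I : set R^o) (fun s : R^o => mat_coord i (V s) : R^o).
  exact: (@smooth_coord R K R^o I oI' n p i V fV.1).
have fterm i : field_along T I c (fun s => mat_coord i (V s) *: P i (c s)).
  have [sP TP] := proj_along i; split.
    exact: (smooth_scale oI' (scoord i) sP).
  move=> s Is; rewrite /stiefel_tangent /= adjZ mmulZl mmulZr -scalerDr.
  by rewrite (TP s Is : _ + _ = 0) scaler0.
have fsum (r : seq ('I_n * 'I_p * bool)) :
    field_along T I c (fun s => \sum_(i <- r) mat_coord i (V s) *: P i (c s)).
  split; first by apply: (smooth_sum oI') => i; exact: (fterm i).1.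
  move=> s Is; elim: r => [|i r IH].
    by rewrite big_nil /stiefel_tangent /= adj0 mmul0l mmul0r addr0.
  rewrite big_cons; move: IH ((fterm i).2 s Is); rewrite /stiefel_tangent /= => IH H.
  by rewrite adjD mmulDl mmulDr addrACA H IH addr0.
have termE i : Dt (fun s => mat_coord i (V s) *: P i (c s)) t =
    derive1 (fun s => mat_coord i (V s) : R^o) t *: P i (c t) +
    mat_coord i (V t) *: nabla (c t) (dc t) (P i).
  rewrite -(cov_chain cov (stiefel_proj_field (mat_basis R K i)) It).
  exact: (cov_leibniz cov (scoord i) (proj_along i) It).
have f0 : field_along T I c (fun=> 0).
  by have := fsum [::]; under eq_fun do rewrite big_nil.
(* The empty sum is handled by the Leibniz rule with the zero function as coefficient. *)
have Dt0 : Dt (fun=> 0) t = 0.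
  have s0 : smooth_on (I : set R^o) (fun=> 0 : R^o) by exact: smooth_cst.
  by have := cov_leibniz cov s0 f0 It; rewrite !scale0r scaler0 addr0.
have sumE (r : seq ('I_n * 'I_p * bool)) :
  Dt (fun s => \sum_(i <- r) mat_coord i (V s) *: P i (c s)) t =
  \sum_(i <- r) (derive1 (fun s => mat_coord i (V s) : R^o) t *: P i (c t) +
    mat_coord i (V t) *: nabla (c t) (dc t) (P i)).
  elim: r => [|i r IH].
    by under eq_fun do rewrite big_nil; rewrite big_nil.
  rewrite big_cons -IH -termE.
  have := cov_linear cov 1 (fterm i) (fsum r) It; rewrite scale1r => <-.
  by congr Dt; apply/funext => s; rewrite big_cons scale1r.
rewrite -sumE; apply: (cov_ext cov fV (fsum _)) => // s Is.
have plin : linear (stiefel_proj (c s)).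
  by move=> a x y; rewrite /stiefel_proj; mat_expand; mat_lin.
(* Projecting the expansion of [V s] on the matrix basis leaves [V s] unchanged and turns the basis
   matrices into the fields [P i]. *)
have VsE := congr1 (stiefel_proj (c s)) (mat_decomp (V s)).
by rewrite (linear_sumZ plin) (stiefel_proj_id (fV.2 s Is)) in VsE.
Qed.

(** The expansion involves [Dt] only through [nabla] on tangent data, where [levi_civita_unique]
    applies. *)
Lemma covariant_unique nabla Dt V t : levi_civita St T g nabla ->
  covariant_derivative_along St T nabla I c Dt -> field_along T I c V -> I t ->
  Dt V t = stiefel_Dt V t.
Proof.
move=> lc cov fV It.
rewrite (covariant_expansion cov fV It) (covariant_expansion stiefel_Dt_covariant fV It).
apply: eq_bigr => i _; congr (_ + _ *: _).
apply: (levi_civita_unique a0 a1 alphaE lc); first exact: cSt.2.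
  exact: curve_velocity.2.
exact: stiefel_proj_field.
Qed.

(** On the diagonal the polarized term is the quadratic one, so the covariant derivative of the
    velocity is the left side of the equation; uniqueness reduces any witnesses of [geodesic] to the
    explicit ones. *)
Lemma stiefel_geodesicP : stiefel_geodesic alpha0 alpha1 I c <->
  forall t, I t -> derive1n 2 c t + c t ** (dc t)^t ** dc t
    + (2 * (1 - alpha)) *: ((mid n - c t ** (c t)^t) ** (dc t ** (dc t)^t) ** c t) = 0.
Proof.
have DtE t : stiefel_Dt dc t = derive1n 2 c t + c t ** (dc t)^t ** dc t
    + (2 * (1 - alpha)) *: ((mid n - c t ** (c t)^t) ** (dc t ** (dc t)^t) ** c t).
  rewrite /stiefel_Dt /stiefel_christoffel /derive1n /=; mat_expand; mat_lin.
split=> [[_ [nabla [Dt [lc cov Dt0]]]] t It|H].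
  by rewrite -DtE -(covariant_unique lc cov curve_velocity It) Dt0.
split=> //; exists nab, stiefel_Dt; split; last by move=> t It; rewrite DtE H.
  exact: stiefel_nabla_levi_civita.
exact: stiefel_Dt_covariant.
Qed.

End StiefelGeodesics.

Lemma smooth_stiefel_exp_curve (R : realType) (K : scalars) n p alpha
    (Y0 eta : mat R K n p) (A S0 : mat R K p p) (I : set R) : open I ->
  smooth_on (I : set R^o) (stiefel_exp_curve alpha Y0 eta A S0 : R^o -> mat R K n p).
Proof.
move=> oI; have oI' : open (I : set R^o) by [].
have s1 := smooth_mmul oI' (smooth_cst oI' (mcol (mid p) 0 : mat R K (p + p) p))
  (@smooth_mexp R K p ((1 - 2 * alpha) *: A) I oI).
have s2 := @smooth_mexp R K _ (mblock ((2 * alpha - 1) *: A)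
  ((2 * (alpha - 1)) *: (A ** A) - S0) (mid p) A) I oI.
have s3 := smooth_mmul oI' (smooth_mmul oI' (smooth_cst oI' (mrow Y0 eta)) s2) s1.
apply: (smooth_ext oI' _ s3) => t _; rewrite /stiefel_exp_curve; congr (_ ** _).
rewrite scalerA mulrC /mcol /mmul mul_col_mx mul1mx mul0mx.
by [].
Qed.

(** * The initial value problem and the two formulas *)

Section InitialValueProblem.
Variables (R : realType) (K : scalars) (n p : nat) (alpha0 alpha1 alpha : R).
Hypothesis (a0 : 0 < alpha0) (a1 : 0 < alpha1).
Hypothesis alphaE : alpha1 = alpha * alpha0.
Variables (Y0 eta : mat R K n p).
Hypothesis Y0St : stiefel Y0.
Hypothesis etaT : stiefel_tangent Y0 eta.

(** [Y] is prescribed only on [I]; as [I] is open, each point has a neighbourhood where [Y] agrees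
    with the formula, so their derivatives agree on [I]. *)
Lemma stiefel_geodesic_ivp (I : set R) (Y : R -> mat R K n p) :
  open I -> is_interval I -> I 0 ->
  [/\ stiefel_geodesic alpha0 alpha1 I Y, Y 0 = Y0 & derive1 Y 0 = eta] <->
  (forall t, I t -> Y t = stiefel_exp_curve alpha Y0 eta (Y0^t ** eta) (eta^t ** eta) t).
Proof.
move=> oI Iitv I0; split=> [[geo Y00 dY0]|YE].
  have [cI _] := geo; have ode := (stiefel_geodesicP a0 a1 alphaE oI cI).1 geo.
  have fdY := curve_velocity oI cI.
  apply: (@stiefel_exp_unique _ _ _ _ alpha Y0 eta _ _ etaT erefl erefl I Y (derive1 Y)) => //.
  - exact: cI.2.
  - exact: fdY.2.
  - by move=> t; exact: curve_has_deriv.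
  move=> t It; apply: has_deriv_eq (field_along_has_deriv fdY It) _.
  by apply/eqP; rewrite -subr_eq0 opprD !opprK addrA; apply/eqP; exact: ode.
have [W /= [cSt dY dW c0 W0]] := stiefel_exp_curveP alpha Y0St etaT erefl erefl.
have nearI t : I t -> \forall s \near t, I s by exact: near_open.
have cI : curve_in (@stiefel R K n p) I Y.
  split; last by move=> t It; rewrite YE //; exact: cSt.
  have oI' : open (I : set R^o) by [].
  apply: (smooth_ext oI' _ (smooth_stiefel_exp_curve alpha Y0 eta _ _ oI)) => t It.
  by rewrite YE.
have dYE t : I t -> derive1 Y t = W t.
  move=> It; apply: has_deriv_derive1; apply: has_deriv_near (dY t).
  by near=> s; apply/esym/YE; near: s; exact: nearI.
split; [|by rewrite YE|by rewrite dYE].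
apply/(stiefel_geodesicP a0 a1 alphaE oI cI) => t It.
have -> : derive1n 2 Y t = derive1 (derive1 Y) t by [].
have nE : \forall s \near t, W s = derive1 Y s.
  by near=> s; apply/esym/dYE; near: s; exact: nearI.
rewrite (has_deriv_derive1 (has_deriv_near nE (dW t))) dYE // YE //.
by apply/eqP; rewrite -addrA addr_eq0 opprD.
Unshelve. all: by end_near. Qed.

Variables (k : nat) (Q : mat R K n k) (Rm : mat R K k p).
Hypothesis QQ : Q^t ** Q = mid k.
Hypothesis etaE : eta - Y0 ** Y0^t ** eta = Q ** Rm.

(** Pythagoras for [eta = Y0 A + Q R]: the two parts are orthogonal, and [A^t ** A = - A ** A] as
    [A] is skew. *)
Lemma stiefel_speed : eta^t ** eta = - (Y0^t ** eta ** (Y0^t ** eta)) + Rm^t ** Rm.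
Proof.
have YY : Y0^t ** Y0 = mid p := Y0St.
have -> : Rm^t ** Rm = (Q ** Rm)^t ** (Q ** Rm).
  by rewrite adjM mmulA -(mmulA _ _ Q) QQ mmul1r.
rewrite -etaE; mat_expand; rewrite -!(mmulA _ Y0^t Y0) YY; mat_expand.
by rewrite (stiefel_skew etaT); mat_expand; mat_lin.
Qed.

Lemma stiefel_exp_curve_qr (t : R) :
  let A := Y0^t ** eta in
  let MN := mexp (t *: mblock ((2 * alpha) *: A) (- Rm^t) Rm 0) ** mcol (mid p) 0 in
  stiefel_exp_curve alpha Y0 eta A (eta^t ** eta) t =
  (Y0 ** usubmx MN + Q ** dsubmx MN) ** mexp (((1 - 2 * alpha) * t) *: A).
Proof.
move=> A MN.
have ME : MN = mcol (usubmx MN) (dsubmx MN) by rewrite /mcol vsubmxK.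
have -> : Y0 ** usubmx MN + Q ** dsubmx MN = mrow Y0 Q ** MN.
  by rewrite [in RHS]ME mrow_col.
(* The columns of [P] are the coordinates of [Y0] and [eta = Y0 A + Q R] with respect to
   [[Y0 Q]]. *)
pose P : mat R K (p + k) (p + p) := mblock (mid p) A 0 Rm.
have YQ : mrow Y0 eta = mrow Y0 Q ** P.
  rewrite /P mrow_block; mat_expand; rewrite addr0; congr mrow.
  by rewrite -etaE /A; mat_expand; mat_lin.
rewrite /stiefel_exp_curve YQ stiefel_speed -/A.
have PB : P ** mexp (t *: mblock ((2 * alpha - 1) *: A)
    ((2 * (alpha - 1)) *: (A ** A) - (- (A ** A) + Rm^t ** Rm)) (mid p) A) =
    mexp (t *: mblock ((2 * alpha) *: A) (- Rm^t) Rm 0) ** P.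
  apply: mexp_intertwine; rewrite mmulZl mmulZr; congr (_ *: _).
  rewrite /P !mblockM; congr mblock; mat_expand; mat_lin.
rewrite -(mmulA _ P) PB -!mmulA; congr (_ ** _); rewrite /MN -?mmulA; congr (_ ** _).
(* [P] maps [[X; 0]] to [[X; 0]], so the trailing exponential is unaffected by the change of
   generator. *)
rewrite /P mblock_col; mat_expand; rewrite !addr0.
by rewrite /mcol /mmul mul_col_mx mul1mx mul0mx.
Qed.

End InitialValueProblem.

Unset Implicit Arguments.

Theorem theorem1 (R : realType) (K : scalars) (n p : nat) (alpha0 alpha1 : R) :
  0 < alpha0 -> 0 < alpha1 ->
  let alpha : R := alpha1 / alpha0 in
  (forall (I : set R) (Y : R -> mat R K n p),
     open I -> is_interval I -> stiefel_curve I Y ->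
     (stiefel_geodesic alpha0 alpha1 I Y <->
      forall t : R, I t ->
        let dY : mat R K n p := derive1 Y t in
        let ddY : mat R K n p := derive1n 2 Y t in
        ddY + Y t ** dY^t ** dY
        + (2 * (1 - alpha)) *:
            ((mid n - Y t ** (Y t)^t) ** (dY ** dY^t) ** Y t) = 0))
  /\
  (forall (Y0 eta : mat R K n p) (k : nat) (Q : mat R K n k) (Rm : mat R K k p),
     stiefel Y0 -> stiefel_tangent Y0 eta ->
     orthonormal_basis_of_columns Q (eta - Y0 ** Y0^t ** eta) ->
     eta - Y0 ** Y0^t ** eta = Q ** Rm ->
     let A : mat R K p p := Y0^t ** eta in
     let S0 : mat R K p p := eta^t ** eta in
     let Y1 : R -> mat R K n p := fun t =>
       mrow Y0 eta
       ** mexp (t *: mblock ((2 * alpha - 1) *: A)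
                            ((2 * (alpha - 1)) *: (A ** A) - S0)
                            (mid p) A)
       ** mcol (mexp (((1 - 2 * alpha) * t) *: A)) 0 in
     let MN : R -> mat R K (p + k) p := fun t =>
       mexp (t *: mblock ((2 * alpha) *: A) (- Rm^t) Rm 0) ** mcol (mid p) 0 in
     let Y2 : R -> mat R K n p := fun t =>
       (Y0 ** usubmx (MN t) + Q ** dsubmx (MN t))
       ** mexp (((1 - 2 * alpha) * t) *: A) in
     S0 = - (A ** A) + Rm^t ** Rm /\
     (forall (I : set R) (Y : R -> mat R K n p),
        open I -> is_interval I -> I 0 ->
        ([/\ stiefel_geodesic alpha0 alpha1 I Y, Y 0 = Y0 & derive1 Y 0 = eta] <->
         (forall t, I t -> Y t = Y1 t)) /\
        ([/\ stiefel_geodesic alpha0 alpha1 I Y, Y 0 = Y0 & derive1 Y 0 = eta] <->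
         (forall t, I t -> Y t = Y2 t)))).
Proof.
move=> a0 a1 alpha; have alphaE : alpha1 = alpha * alpha0.
  by rewrite /alpha divfK // gt_eqF.
split=> [I Y oI Iitv cI|]; first exact: (stiefel_geodesicP a0 a1 alphaE oI cI).
move=> Y0 eta k Q Rm Y0St etaT [QQ _] etaE A S0 Y1 MN Y2.
split; first exact: (stiefel_speed Y0St etaT QQ etaE).
move=> I Y oI Iitv I0.
have ivp := stiefel_geodesic_ivp a0 a1 alphaE Y0St etaT Y oI Iitv I0.
split; first exact: ivp.
have Y2E t : Y2 t = Y1 t := esym (stiefel_exp_curve_qr alpha Y0St etaT QQ etaE t).
by split=> [/ivp|] H; [|apply/ivp] => t It; rewrite H // Y2E.
Qed.
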